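(* If $p>q\ge0$, then $F_p\prec F_q$ in $\mathbb D$, and consequently $\mathcal T_p(\mathbb D)\subseteq\mathcal T_q(\mathbb D)$.
   Context: $\mathbb D=\{z\in\mathbb C:|z|<1\}$. For $f,g$ analytic in $\mathbb D$, $f\prec g$ ($f$ is subordinate to $g$) means that there is an analytic function $\omega:\mathbb D\to\mathbb D$ with $\omega(0)=0$ and $f(z)=g(\omega(z))$ for all $z\in\mathbb D$. For $\nu\ge0$, $$F_\nu(z)={}_1F_2\left(\nu+\tfrac12;\nu+2,2\nu+1;-z\right)=\sum_{n\ge0}\frac{(-1)^n(\nu+\frac12)_n}{(\nu+2)_n(2\nu+1)_n\,n!}z^n,$$ where $(a)_n=a(a+1)\cdots(a+n-1)$, $(a)_0=1$. With $J_\nu$ the Bessel function of the first kind, the normalized Turánian is $$\mathcal T_\nu(z)=2^{2\nu}\Gamma(\nu+1)\Gamma(\nu+2)z^{-2\nu}\left(J_\nu^2(z)-J_{\nu-1}(z)J_{\nu+1}(z)\right)={}_1F_2\left(\nu+\tfrac12;\nu+2,2\nu+1;-z^2\right),$$ regarded as an entire function, so that $\mathcal T_\nu(z)=F_\nu(z^2)$. *)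

(* Defs.v *)
(* Stdlib reals with Coquelicot's complex numbers. *)
From Stdlib Require Import Reals Factorial.
From Coquelicot Require Import Coquelicot.
Open Scope R_scope.

Definition unit_disc (z : C) : Prop := Cmod z < 1.

Definition analytic_on (D : C -> Prop) (f : C -> C) : Prop :=
  forall z : C, D z -> @ex_derive C_AbsRing C_NormedModule f z.

(* Functions on the disc are total functions [C -> C] whose values outside the
   disc are irrelevant. *)
Definition subordinate (f g : C -> C) : Prop :=
  analytic_on unit_disc f /\ analytic_on unit_disc g /\
  exists omega : C -> C,
    analytic_on unit_disc omega /\
    (forall z : C, unit_disc z -> unit_disc (omega z)) /\
    omega (RtoC 0) = RtoC 0 /\
    (forall z : C, unit_disc z -> f z = g (omega z)).

Definition image (f : C -> C) (D : C -> Prop) (w : C) : Prop :=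
  exists z : C, D z /\ f z = w.

(* Like [Series], meaningful for convergent series only; all the series below
   converge absolutely. *)
Definition Cseries (u : nat -> C) : C :=
  (Series (fun n => Re (u n)), Series (fun n => Im (u n))).

Fixpoint pochhammer (a : R) (n : nat) : R :=
  match n with
  | O => 1
  | S m => pochhammer a m * (a + INR m)
  end.

Definition hyp1F2 (a b c : R) (z : C) : C :=
  Cseries (fun n =>
    (RtoC (pochhammer a n
           / (pochhammer b n * pochhammer c n * INR (fact n))) * z ^ n)%C).

Definition F (nu : R) (z : C) : C :=
  hyp1F2 (nu + 1 / 2) (nu + 2) (2 * nu + 1) (- z)%C.

(* The reciprocal Gamma function on the whole real line, by Gauss's formula
     1 / Gamma(x) = lim_n x (x+1) ... (x+n) / (n! n^x).
   It vanishes at the poles 0, -1, -2, ... of Gamma, which is what the Bessel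
   function of order -1 (occurring in the Turanian for nu = 0) needs. *)
Definition rGamma (x : R) : R :=
  real (Lim_seq (fun n =>
    pochhammer x (S n) / (INR (fact n) * Rpower (INR n) x))).

(* Meaningful away from the poles. *)
Definition Gamma (x : R) : R := / rGamma x.

(* Principal argument of z <> 0, with values in (-PI, PI]. *)
Definition Carg (z : C) : R :=
  if Rlt_dec (Im z) 0 then - acos (Re z / Cmod z) else acos (Re z / Cmod z).

(* Principal branch of z^a, for z <> 0 and a real exponent. *)
Definition Cpowr (z : C) (a : R) : C :=
  (Rpower (Cmod z) a * cos (a * Carg z),
   Rpower (Cmod z) a * sin (a * Carg z)).

(* J_nu(z) = (z/2)^nu sum_n (-1)^n (z/2)^(2n) / (n! Gamma(n+nu+1)), z <> 0. *)
Definition besselJ (nu : R) (z : C) : C :=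
  (Cpowr (z / RtoC 2) nu *
   Cseries (fun n =>
     RtoC ((-1) ^ n * rGamma (INR n + nu + 1) / INR (fact n))
     * (z / RtoC 2) ^ (2 * n)))%C.

(* The powers z^(-2nu), (z/2)^(2nu) are all taken on the principal branch, so
   the branch factors cancel exactly for every z <> 0 (the negative axis
   included); the singularity at 0 is removable, with limit 1. *)
Definition turanian (nu : R) (z : C) : C :=
  if Ceq_dec z (RtoC 0) then RtoC 1
  else
    (RtoC (Rpower 2 (2 * nu) * Gamma (nu + 1) * Gamma (nu + 2))
     * Cpowr z (- (2 * nu))
     * (besselJ nu z ^ 2 - besselJ (nu - 1) z * besselJ (nu + 1) z))%C.

(* Main.v *)
Require Import Defs.
From Stdlib Require Import Reals Lra Lia Factorial.
From Coquelicot Require Import Coquelicot.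
Open Scope R_scope.

(** Write F_nu(z) = sum_n (-1)^n c_n(nu) z^n.  The coefficients decay so fast that
    F_nu is close to the affine function 1 - c_1(nu) z on the whole disc, and
    everything follows from a quantitative version of this remark.

    Put delta = 1 - c_1(p)/c_1(q) = (p - q)/(p + 2).  For a given z in the disc,
    the equation F_q(w) = F_p(z) is a fixed point equation w = phi(w), where
    phi(w) = w + (F_q(w) - F_p(z))/c_1(q) (Newton's method with the slope at 0).
    The linear parts alone would give w = (1 - delta) z.  The closed disc B with
    centre (1 - delta) z and radius delta |z| is internally tangent to the circle
    |w| = |z| at z, so that B lies in the disc |w| <= |z|, and phi maps B into
    itself as soon as
        2 delta sum_(n >= 2) n c_n(q) + sum_(n >= 2) |c_n(p) - c_n(q)|
          <= delta c_1(q).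
    Both sides are of order delta, hence the argument works however close p is
    to q.  The same inequality makes phi a contraction, so it has a fixed point
    omega(z), with |omega(z)| <= |z|.  It also makes F_q expand distances by at
    least c_1(q)/2 times, so F_q has a nonzero derivative and an explicit
    quadratic remainder estimate shows that omega is complex differentiable.
    This is [subordinate_Cpseries].

    The inequality itself comes from c_q - c_p <= (2n-1) delta c_q for the n-th
    coefficients ([coef_difference]), which bounds the left-hand side by
    delta sum_(n >= 2) (4n-1) c_n(q), and from the geometric estimate
    [weighted_coef_le], whose sum is exactly c_1(q).

    For the images, T_nu(z) = F_nu(z^2) ([turanian_F]), and squaring maps the disc
    onto itself: if w = F_p(z^2) = F_q(omega(z^2)), then w = T_q(v) for any square
    root v of omega(z^2).  The identity T_nu(z) = F_nu(z^2) is obtained by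
    multiplying the Bessel series: both J_nu^2 and J_(nu-1) J_(nu+1) have
    coefficients given by Vandermonde's identity, with the same binomial
    coefficient, so that their difference is a single product.  All the Gamma
    factors are reduced to Gamma(nu + 1) by the functional equation, which is
    derived from Gauss's limit formula. *)

(** * Absolutely convergent complex series *)

Definition Csummable (u : nat -> C) : Prop := ex_series (fun n => Cmod (u n)).

Lemma Series_nonneg (a : nat -> R) : (forall n, 0 <= a n) -> ex_series a -> 0 <= Series a.
Proof.
  intros Ha He. rewrite <- (Rmult_0_l (Series a)), <- Series_scal_l.
  apply Series_le; [|exact He]. intros n. rewrite Rmult_0_l. split; [lra | apply Ha].
Qed.

Lemma Rabs_Im_le_Cmod (z : C) : Rabs (Im z) <= Cmod z.
Proof. exact (Rle_trans _ _ _ (Rmax_r _ _) (Rmax_Cmod z)). Qed.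

Lemma ex_series_Rabs_le (a b : nat -> R) :
  (forall n, Rabs (a n) <= b n) -> ex_series b -> ex_series a.
Proof. exact (ex_series_le (K := R_AbsRing) (V := R_CompleteNormedModule) a b). Qed.

Lemma Csummable_le (u : nat -> C) (b : nat -> R) :
  (forall n, Cmod (u n) <= b n) -> ex_series b -> Csummable u.
Proof.
  intros Hu Hb. apply ex_series_Rabs_le with b; [intros n | exact Hb].
  rewrite Rabs_pos_eq by apply Cmod_ge_0. apply Hu.
Qed.

Lemma Csummable_Re (u : nat -> C) :
  Csummable u -> ex_series (fun n => Re (u n)).
Proof.
  intros Hu. apply ex_series_Rabs_le with (2 := Hu). intros n. apply re_le_Cmod.
Qed.

Lemma Csummable_Im (u : nat -> C) :
  Csummable u -> ex_series (fun n => Im (u n)).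
Proof.
  intros Hu. apply ex_series_Rabs_le with (2 := Hu). intros n. apply Rabs_Im_le_Cmod.
Qed.

Lemma Cseries_ext (u v : nat -> C) :
  (forall n, u n = v n) -> Cseries u = Cseries v.
Proof.
  intros H. unfold Cseries. f_equal; apply Series_ext; intros n; now rewrite H.
Qed.

Lemma ex_series_mult_l (c : R) (a : nat -> R) :
  ex_series a -> ex_series (fun n => c * a n).
Proof. exact (ex_series_scal_l (K := R_AbsRing) (V := R_NormedModule) c a). Qed.

Lemma Cseries_scal (c : C) (u : nat -> C) : Csummable u ->
  Cseries (fun n => c * u n)%C = (c * Cseries u)%C.
Proof.
  intros Hu. pose proof (Csummable_Re u Hu) as Hr. pose proof (Csummable_Im u Hu) as Hi.
  unfold Cseries, Cmult at 3. simpl. f_equal; rewrite <- !Series_scal_l.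
  - exact (Series_minus _ _ (ex_series_mult_l _ _ Hr) (ex_series_mult_l _ _ Hi)).
  - exact (Series_plus _ _ (ex_series_mult_l _ _ Hi) (ex_series_mult_l _ _ Hr)).
Qed.

Lemma Cseries_minus (u v : nat -> C) : Csummable u -> Csummable v ->
  Cseries (fun n => u n - v n)%C = (Cseries u - Cseries v)%C.
Proof.
  intros Hu Hv. apply injective_projections.
  - exact (Series_minus _ _ (Csummable_Re u Hu) (Csummable_Re v Hv)).
  - exact (Series_minus _ _ (Csummable_Im u Hu) (Csummable_Im v Hv)).
Qed.

Lemma Cseries_incr (u : nat -> C) : Csummable u ->
  Cseries u = (u O + Cseries (fun n => u (S n)))%C.
Proof.
  intros Hu. unfold Cseries, Cplus. simpl. f_equal;
  rewrite Series_incr_1; trivial;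
  [now apply Csummable_Re | now apply Csummable_Im].
Qed.

Lemma Cmod_sqr (z : C) : Cmod z * Cmod z = Re z * Re z + Im z * Im z.
Proof.
  unfold Cmod, Re, Im. rewrite sqrt_sqrt; [ring|].
  apply Rplus_le_le_0_compat; apply pow2_ge_0.
Qed.

Lemma Rabs_dot_le (s z : C) :
  Rabs (Re s * Re z + Im s * Im z) <= Cmod s * Cmod z.
Proof.
  replace (Re s * Re z + Im s * Im z) with (Re (Cconj s * z)%C)
    by (unfold Re, Im, Cconj, Cmult; simpl; ring).
  apply Rle_trans with (1 := re_le_Cmod _).
  rewrite Cmod_mult, Cmod_conj. apply Rle_refl.
Qed.

(** The triangle inequality for series, obtained by projecting every term on
    the direction of the sum. *)
Lemma Cmod_Cseries_le (u : nat -> C) (b : nat -> R) :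
  (forall n, Cmod (u n) <= b n) -> ex_series b -> Cmod (Cseries u) <= Series b.
Proof.
  intros Hu Hb. pose proof (Csummable_le u b Hu Hb) as Hs.
  apply Rle_trans with (Series (fun n => Cmod (u n))).
  2: { apply Series_le; [|exact Hb]. intros n. split; [apply Cmod_ge_0 | apply Hu]. }
  set (s := Cseries u).
  destruct (Req_dec (Cmod s) 0) as [H0|H0].
  { rewrite H0. apply Series_nonneg; [intros n; apply Cmod_ge_0 | exact Hs]. }
  assert (Hpos : 0 < Cmod s) by (pose proof (Cmod_ge_0 s); lra).
  apply Rmult_le_reg_l with (1 := Hpos).
  rewrite Cmod_sqr, <- Series_scal_l.
  pose proof (Csummable_Re u Hs) as Hr. pose proof (Csummable_Im u Hs) as Hi.
  unfold s at 2 4, Cseries. simpl. rewrite <- !Series_scal_l.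
  assert (Hr' : ex_series (fun n => Re s * Re (u n)))
    by now apply ex_series_mult_l.
  assert (Hi' : ex_series (fun n => Im s * Im (u n)))
    by now apply ex_series_mult_l.
  rewrite <- Series_plus by assumption.
  assert (Hm : ex_series (fun n => Cmod s * Cmod (u n)))
    by now apply ex_series_mult_l.
  assert (Ha : ex_series (fun n => Rabs (Re s * Re (u n) + Im s * Im (u n)))).
  { apply ex_series_Rabs_le with (2 := Hm). intros n.
    rewrite Rabs_Rabsolu. apply Rabs_dot_le. }
  apply Rle_trans with (1 := Rle_abs _). apply Rle_trans with (1 := Series_Rabs _ Ha).
  apply Series_le; [|exact Hm]. intros n. split; [apply Rabs_pos | apply Rabs_dot_le].
Qed.

Definition conv (a b : nat -> R) (n : nat) : R :=
  sum_f_R0 (fun k => a k * b (n - k)%nat) n.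

Definition Cpseries (a : nat -> R) (z : C) : C :=
  Cseries (fun n => RtoC (a n) * z ^ n)%C.

(** The Cauchy product of complex series, split into the four Cauchy products of
    real and imaginary parts. *)
Lemma Cpseries_mult (a b : nat -> R) (z : C) :
  Csummable (fun n => RtoC (a n) * z ^ n)%C -> Csummable (fun n => RtoC (b n) * z ^ n)%C ->
  (Cpseries a z * Cpseries b z)%C = Cpseries (conv a b) z.
Proof.
  set (u := fun n => (RtoC (a n) * z ^ n)%C). set (v := fun n => (RtoC (b n) * z ^ n)%C).
  intros Hu Hv.
  pose proof (Csummable_Re u Hu) as Hur. pose proof (Csummable_Im u Hu) as Hui.
  pose proof (Csummable_Re v Hv) as Hvr. pose proof (Csummable_Im v Hv) as Hvi.
  assert (Ha : forall f : C -> R, (forall z, Rabs (f z) <= Cmod z) ->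
     forall w, Csummable w -> ex_series (fun n => Rabs (f (w n)))).
  { intros f Hf w Hw. apply ex_series_Rabs_le with (2 := Hw). intros n.
    rewrite Rabs_Rabsolu. apply Hf. }
  pose proof (Ha _ re_le_Cmod _ Hu) as Aur.
  pose proof (Ha _ Rabs_Im_le_Cmod _ Hu) as Aui.
  pose proof (Ha _ re_le_Cmod _ Hv) as Avr.
  pose proof (Ha _ Rabs_Im_le_Cmod _ Hv) as Avi.
  pose proof (is_series_mult _ _ _ _ (Series_correct _ Hur) (Series_correct _ Hvr) Aur Avr)
    as Prr.
  pose proof (is_series_mult _ _ _ _ (Series_correct _ Hui) (Series_correct _ Hvi) Aui Avi)
    as Pii.
  pose proof (is_series_mult _ _ _ _ (Series_correct _ Hur) (Series_correct _ Hvi) Aur Avi)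
    as Pri.
  pose proof (is_series_mult _ _ _ _ (Series_correct _ Hui) (Series_correct _ Hvr) Aui Avr)
    as Pir.
  assert (Huv : forall n k, (k <= n)%nat ->
     (u k * v (n - k)%nat)%C = (RtoC (a k * b (n - k)%nat) * z ^ n)%C).
  { intros n k Hk. unfold u, v. replace (z ^ n)%C with (z ^ (k + (n - k)))%C by (f_equal; lia).
    rewrite Cpow_add_r, RtoC_mult. ring. }
  unfold Cpseries, Cseries at 1 2. fold u v. unfold Cmult at 1. simpl.
  unfold Cseries. f_equal; symmetry; apply is_series_unique.
  - eapply is_series_ext; [|exact (is_series_minus _ _ _ _ Prr Pii)].
    intros n. rewrite re_scal_l. unfold minus, plus, opp; simpl.
    match goal with |- ?x + - ?y = _ => change (x + - y) with (x - y) end.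
    rewrite <- minus_sum. unfold conv. rewrite Rmult_comm, scal_sum. apply sum_eq.
    intros k Hk. rewrite <- (re_scal_l (a k * b (n - k)%nat)), <- (Huv n k Hk). reflexivity.
  - eapply is_series_ext; [|exact (is_series_plus _ _ _ _ Pri Pir)].
    intros n. rewrite im_scal_l. unfold plus; simpl. rewrite <- sum_plus.
    unfold conv. rewrite Rmult_comm, scal_sum. apply sum_eq.
    intros k Hk. rewrite <- (im_scal_l (a k * b (n - k)%nat)), <- (Huv n k Hk). reflexivity.
Qed.

(** * Power series with real coefficients on the disc *)

(** A quantitative form of differentiability at z with derivative l.  Unlike the
    derivative itself it is explicit enough to pass to an inverse function by
    plain inequalities. *)
Definition quadratic_remainder (f : C -> C) (z l : C) : Prop :=
  exists M, 0 <= M /\ forall w, unit_disc w ->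
    Cmod (f w - f z - l * (w - z)) <= M * (Cmod (w - z) * Cmod (w - z)).

Lemma Cmod_le_plus_minus (z w : C) : Cmod w <= Cmod z + Cmod (w - z).
Proof. replace w with (z + (w - z))%C at 1 by ring. apply Cmod_triangle. Qed.

Lemma ex_derive_quadratic_remainder (f : C -> C) (z l : C) :
  unit_disc z -> quadratic_remainder f z l ->
  @ex_derive C_AbsRing C_NormedModule f z.
Proof.
  unfold unit_disc. intros Hz (M & HM & Hf). exists l. split.
  { apply (is_linear_scal_l (K := C_AbsRing) (V := C_NormedModule) l). }
  intros x Hx eps.
  rewrite <- (is_filter_lim_locally_unique (V := AbsRing_NormedModule C_AbsRing) z x Hx).
  clear x Hx.
  assert (Hd : 0 < Rmin (1 - Cmod z) (eps / (M + 1))).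
  { apply Rmin_glb_lt; [lra|]. apply Rdiv_lt_0_compat; [apply cond_pos | lra]. }
  exists (mkposreal _ Hd). intros w Hw.
  change (Cmod (w - z) < Rmin (1 - Cmod z) (eps / (M + 1))) in Hw.
  change (Cmod (f w - f z - (w - z) * l) <= eps * Cmod (w - z)).
  pose proof (Rlt_le_trans _ _ _ Hw (Rmin_l _ _)) as H1.
  pose proof (Rlt_le_trans _ _ _ Hw (Rmin_r _ _)) as H2.
  pose proof (Cmod_le_plus_minus z w) as H3.
  rewrite (Cmult_comm (w - z) l).
  apply Rle_trans with (1 := Hf w ltac:(unfold unit_disc; lra)).
  rewrite <- Rmult_assoc. apply Rmult_le_compat_r; [apply Cmod_ge_0|].
  apply Rle_trans with ((M + 1) * (eps / (M + 1))); [|right; field; lra].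
  pose proof (Cmod_ge_0 (w - z)). nra.
Qed.

Lemma Cmod_pow_le_1 (z : C) (n : nat) : Cmod z <= 1 -> Cmod (z ^ n) <= 1.
Proof.
  intros Hz. rewrite Cmod_pow. rewrite <- (pow1 n). apply pow_incr.
  split; [apply Cmod_ge_0 | exact Hz].
Qed.

Lemma Cmod_pow_minus_le (w z : C) (n : nat) : Cmod w <= 1 -> Cmod z <= 1 ->
  Cmod (w ^ n - z ^ n) <= INR n * Cmod (w - z).
Proof.
  intros Hw Hz. induction n as [|n IH].
  { simpl. replace (1 - 1)%C with (RtoC 0) by ring. rewrite Cmod_0. lra. }
  replace (w ^ S n - z ^ S n)%C with (w * (w ^ n - z ^ n) + z ^ n * (w - z))%C
    by (rewrite !Cpow_S; ring).
  apply Rle_trans with (1 := Cmod_triangle _ _). rewrite !Cmod_mult, S_INR.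
  pose proof (Cmod_pow_le_1 z n Hz). pose proof (Cmod_ge_0 (w - z)).
  pose proof (Cmod_ge_0 (w ^ n - z ^ n)). nra.
Qed.

(** The remainder R_n satisfies R_(n+1) = w R_n + n z^(n-1) (w - z)^2. *)
Lemma Cmod_pow_taylor_le (w z : C) (n : nat) : Cmod w <= 1 -> Cmod z <= 1 ->
  Cmod (w ^ n - z ^ n - RtoC (INR n) * z ^ pred n * (w - z))
  <= INR n ^ 2 * (Cmod (w - z) * Cmod (w - z)).
Proof.
  intros Hw Hz. destruct n as [|n].
  { simpl. replace (1 - 1 - 0 * 1 * (w - z))%C with (RtoC 0) by ring.
    rewrite Cmod_0. lra. }
  simpl pred. induction n as [|n IH].
  { rewrite !Cpow_1_r. simpl.
    replace (w - z - 1 * 1 * (w - z))%C with (RtoC 0) by ring.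
    rewrite Cmod_0. pose proof (Cmod_ge_0 (w - z)). nra. }
  replace (w ^ S (S n) - z ^ S (S n) - RtoC (INR (S (S n))) * z ^ S n * (w - z))%C
    with (w * (w ^ S n - z ^ S n - RtoC (INR (S n)) * z ^ n * (w - z))
          + RtoC (INR (S n)) * (z ^ n * ((w - z) * (w - z))))%C
    by (rewrite (S_INR (S n)), RtoC_plus, !Cpow_S; ring).
  apply Rle_trans with (1 := Cmod_triangle _ _).
  rewrite !Cmod_mult, (S_INR (S n)), Cmod_R, (Rabs_pos_eq _ (pos_INR (S n))).
  pose proof (Cmod_pow_le_1 z n Hz) as H1.
  set (e := Cmod (w ^ S n - z ^ S n - RtoC (INR (S n)) * z ^ n * (w - z))) in *.
  pose proof (pos_INR (S n)). set (h := Cmod (w - z)) in *.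
  assert (0 <= h * h) by (assert (0 <= h) by apply Cmod_ge_0; nra).
  assert (0 <= e) by apply Cmod_ge_0.
  assert (Cmod w * e <= e) by nra.
  assert (Cmod (z ^ n) * (h * h) <= h * h) by (pose proof (Cmod_ge_0 (z ^ n)); nra).
  nra.
Qed.

(** The weight is the one that [Cmod_pow_taylor_le] asks for, shifted by one so that
    it dominates 1 and n as well as n^2, the index 0 included. *)
Definition sqr_summable (a : nat -> R) : Prop :=
  ex_series (fun n => INR (S n) ^ 2 * Rabs (a n)).

Lemma sqr_summable_Rabs_mult (a b : nat -> R) : sqr_summable a ->
  (forall n, Rabs (b n) <= INR (S n) ^ 2) -> ex_series (fun n => b n * Rabs (a n)).
Proof.
  intros Ha Hb. apply ex_series_Rabs_le with (2 := Ha). intros n.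
  rewrite Rabs_mult, Rabs_Rabsolu.
  apply Rmult_le_compat_r; [apply Rabs_pos | apply Hb].
Qed.

Lemma INR_le_sqr_succ (n : nat) : INR n <= INR (S n) ^ 2.
Proof. rewrite S_INR. pose proof (pos_INR n). nra. Qed.

Lemma sqr_summable_INR_mult (a : nat -> R) : sqr_summable a ->
  ex_series (fun n => INR n * Rabs (a n)).
Proof.
  intros Ha. apply sqr_summable_Rabs_mult with (1 := Ha). intros n.
  rewrite Rabs_pos_eq by apply pos_INR. apply INR_le_sqr_succ.
Qed.

Lemma sqr_summable_ex_series_Rabs (a : nat -> R) : sqr_summable a -> ex_series (fun n => Rabs (a n)).
Proof.
  intros Ha. apply ex_series_Rabs_le with (2 := Ha). intros n.
  rewrite Rabs_Rabsolu, S_INR. pose proof (pos_INR n). pose proof (Rabs_pos (a n)). nra.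
Qed.

Lemma Cmod_RtoC_mult_le (x M : R) (w : C) : Cmod w <= M ->
  Cmod (RtoC x * w) <= M * Rabs x.
Proof.
  intros H. rewrite Cmod_mult, Cmod_R, Rmult_comm.
  apply Rmult_le_compat_r; [apply Rabs_pos | exact H].
Qed.

Lemma sqr_summable_Csummable (a : nat -> R) (z : C) : sqr_summable a -> Cmod z <= 1 ->
  Csummable (fun n => RtoC (a n) * z ^ n)%C.
Proof.
  intros Ha Hz. apply Csummable_le with (2 := sqr_summable_ex_series_Rabs a Ha). intros n.
  rewrite <- (Rmult_1_l (Rabs (a n))). now apply Cmod_RtoC_mult_le, Cmod_pow_le_1.
Qed.

Lemma Cpseries_quadratic_remainder (a : nat -> R) (z : C) : sqr_summable a -> unit_disc z ->
  quadratic_remainder (Cpseries a) z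
    (Cseries (fun n => RtoC (a n) * (RtoC (INR n) * z ^ pred n)))%C.
Proof.
  intros Ha Hz. assert (Hz1 : Cmod z <= 1) by (apply Rlt_le, Hz).
  assert (Hd : Csummable (fun n => RtoC (a n) * (RtoC (INR n) * z ^ pred n))%C).
  { apply Csummable_le with (2 := sqr_summable_INR_mult a Ha). intros n.
    apply Cmod_RtoC_mult_le. rewrite Cmod_mult, Cmod_R, Rabs_pos_eq by apply pos_INR.
    pose proof (Cmod_pow_le_1 z (pred n) Hz1). pose proof (pos_INR n). nra. }
  assert (Hs : ex_series (fun n => INR n ^ 2 * Rabs (a n))).
  { apply sqr_summable_Rabs_mult with (1 := Ha). intros n.
    rewrite S_INR. pose proof (pos_INR n). rewrite Rabs_pos_eq; nra. }
  exists (Series (fun n => INR n ^ 2 * Rabs (a n))). split.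
  { apply Series_nonneg; [|exact Hs]. intros n.
    apply Rmult_le_pos; [apply pow2_ge_0 | apply Rabs_pos]. }
  intros w Hw. assert (Hw1 : Cmod w <= 1) by (apply Rlt_le, Hw).
  rewrite (Cmult_comm _ (w - z)), <- (Cseries_scal (w - z)) by exact Hd.
  unfold Cpseries.
  assert (Hm : Csummable (fun n => RtoC (a n) * w ^ n - RtoC (a n) * z ^ n)%C).
  { apply Csummable_le with (b := fun n => Rabs (a n) + Rabs (a n)).
    2: { pose proof (sqr_summable_ex_series_Rabs a Ha) as H.
         exact (ex_series_plus _ _ H H). }
    intros n. apply Rle_trans with (1 := Cmod_triangle _ _). rewrite Cmod_opp.
    rewrite <- (Rmult_1_l (Rabs (a n))).
    apply Rplus_le_compat; now apply Cmod_RtoC_mult_le, Cmod_pow_le_1. }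
  assert (Hd' : Csummable (fun n =>
      (w - z) * (RtoC (a n) * (RtoC (INR n) * z ^ pred n)))%C).
  { eapply ex_series_ext; [|exact (ex_series_mult_l (Cmod (w - z)) _ Hd)].
    intros n. simpl. now rewrite (Cmod_mult (w - z)). }
  rewrite <- Cseries_minus; try now apply sqr_summable_Csummable.
  rewrite <- Cseries_minus by assumption.
  rewrite <- Series_scal_r. apply Cmod_Cseries_le.
  - intros n.
    replace (RtoC (a n) * w ^ n - RtoC (a n) * z ^ n
      - (w - z) * (RtoC (a n) * (RtoC (INR n) * z ^ pred n)))%C
      with (RtoC (a n) * (w ^ n - z ^ n - RtoC (INR n) * z ^ pred n * (w - z)))%C by ring.
    rewrite Cmod_mult, Cmod_R.
    pose proof (Cmod_pow_taylor_le w z n Hw1 Hz1). pose proof (Rabs_pos (a n)). nra.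
  - now apply ex_series_scal_r.
Qed.

Lemma Cpseries_analytic (a : nat -> R) : sqr_summable a -> analytic_on unit_disc (Cpseries a).
Proof.
  intros Ha z Hz. eapply ex_derive_quadratic_remainder; [exact Hz|].
  now apply Cpseries_quadratic_remainder.
Qed.

(** * Fixed points of contractions of a disc *)

Lemma le_0_of_le_geom (y K k : R) : 0 <= k < 1 -> (forall n, y <= k ^ n * K) -> y <= 0.
Proof.
  intros Hk H.
  apply (is_lim_seq_le (fun _ => y) (fun n => k ^ n * K) y 0 H (is_lim_seq_const y)).
  replace 0 with (0 * K) by ring.
  apply (is_lim_seq_mult' _ _ 0 K); [|apply is_lim_seq_const].
  apply is_lim_seq_geom. rewrite Rabs_pos_eq; lra.
Qed.

(** Banach's fixed point theorem.  The limit of the iterates is written as the sum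
    of the series of their increments, which keeps it explicit: the existential is
    in [Type], so that a family of contractions has a function of fixed points
    without any choice. *)
Lemma contraction_fixed_point (phi : C -> C) (c : C) (r k : R) :
  0 <= r -> 0 <= k < 1 ->
  (forall w, Cmod (w - c) <= r -> Cmod (phi w - c) <= r) ->
  (forall v w, Cmod (v - c) <= r -> Cmod (w - c) <= r ->
     Cmod (phi v - phi w) <= k * Cmod (v - w)) ->
  {w : C | Cmod (w - c) <= r /\ phi w = w}.
Proof.
  intros Hr Hk Hball Hlip.
  set (x := fun n => Nat.iter n phi c). set (d := fun n => (x (S n) - x n)%C).
  assert (Hx : forall n, Cmod (x n - c) <= r).
  { induction n as [|n IH]; [|now apply Hball].
    unfold x; simpl. replace (c - c)%C with (RtoC 0) by ring. now rewrite Cmod_0. }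
  assert (Hd : forall n, Cmod (d n) <= k ^ n * r).
  { induction n as [|n IH].
    - rewrite Rmult_1_l. apply (Hx 1%nat).
    - change (Cmod (phi (x (S n)) - phi (x n)) <= k * k ^ n * r).
      apply Rle_trans with (1 := Hlip _ _ (Hx _) (Hx _)).
      rewrite Rmult_assoc. apply Rmult_le_compat_l; [lra | exact IH]. }
  assert (Hg : ex_series (fun n => k ^ n * r))
    by (apply ex_series_scal_r, ex_series_geom; rewrite Rabs_pos_eq; lra).
  set (K := Series (fun n => k ^ n * r)).
  set (w := (c + Cseries d)%C).
  assert (Hgn : forall n, ex_series (fun m => k ^ n * (k ^ m * r)))
    by (intros n; now apply ex_series_mult_l).
  assert (Hdn : forall n m, Cmod (d (n + m)%nat) <= k ^ n * (k ^ m * r))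
    by (intros n m; rewrite <- Rmult_assoc, <- pow_add; apply Hd).
  assert (Hw : forall n, (w - x n)%C = Cseries (fun m => d (n + m)%nat)).
  { induction n as [|n IH].
    - change (x 0%nat) with c. unfold w.
      rewrite (Cseries_ext (fun m => d (0 + m)%nat) d) by reflexivity. ring.
    - rewrite (Cseries_incr _ (Csummable_le _ _ (Hdn n) (Hgn n))) in IH.
      rewrite Nat.add_0_r in IH.
      rewrite (Cseries_ext (fun m => d (S n + m)%nat) (fun m => d (n + S m)%nat))
        by (intros m; f_equal; lia).
      replace (w - x (S n))%C with (w - x n - d n)%C by (unfold d; ring).
      rewrite IH. ring. }
  assert (Hwn : forall n, Cmod (w - x n) <= k ^ n * K).
  { intros n. rewrite Hw. unfold K. rewrite <- Series_scal_l.
    apply Cmod_Cseries_le; [apply Hdn | apply Hgn]. }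
  assert (Hwc : Cmod (w - c) <= r).
  { cut (Cmod (w - c) - r <= 0); [lra|].
    apply le_0_of_le_geom with (1 := Hk) (K := K). intros n.
    replace (w - c)%C with ((w - x n) + (x n - c))%C by ring.
    pose proof (Cmod_triangle (w - x n) (x n - c)). pose proof (Hx n).
    pose proof (Hwn n). lra. }
  exists w. split; [exact Hwc|].
  apply Ceq_minus, Cmod_eq_0, Rle_antisym; [|apply Cmod_ge_0].
  apply le_0_of_le_geom with (1 := Hk) (K := 2 * k * K). intros n.
  replace (phi w - w)%C with ((phi w - phi (x n)) + - (w - x (S n)))%C
    by (unfold x; simpl; ring).
  apply Rle_trans with (1 := Cmod_triangle _ _). rewrite Cmod_opp.
  pose proof (Hlip _ _ Hwc (Hx n)). pose proof (Hwn n).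
  pose proof (Hwn (S n)) as H1. change (k ^ S n) with (k * k ^ n) in H1.
  assert (k * Cmod (w - x n) <= k * (k ^ n * K)) by (apply Rmult_le_compat_l; lra).
  lra.
Qed.

(** * A coefficient criterion for subordination *)

Definition Ctail (a : nat -> R) (z : C) : C :=
  Cseries (fun n => RtoC (a (S (S n))) * z ^ S (S n))%C.

(** The Lipschitz constant on the closed disc of the part of degree at least 2. *)
Definition tail_variation (a : nat -> R) : R :=
  Series (fun n => INR (S (S n)) * Rabs (a (S (S n)))).

Lemma ex_series_shift2 (a : nat -> R) : ex_series a -> ex_series (fun n => a (S (S n))).
Proof. intros H. apply (ex_series_incr_n a 2) in H. exact H. Qed.

Lemma Cpseries_split (a : nat -> R) (z : C) : sqr_summable a -> Cmod z <= 1 ->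
  Cpseries a z = (RtoC (a 0%nat) + RtoC (a 1%nat) * z + Ctail a z)%C.
Proof.
  intros Ha Hz. pose proof (sqr_summable_Csummable a z Ha Hz) as Hs.
  unfold Cpseries. rewrite Cseries_incr by exact Hs. rewrite Cseries_incr.
  - simpl Cpow at 1. rewrite Cpow_1_r. unfold Ctail. ring.
  - apply (ex_series_incr_1 (fun n => Cmod (RtoC (a n) * z ^ n))) in Hs. exact Hs.
Qed.

Lemma Ctail_summable (a : nat -> R) (z : C) : sqr_summable a -> Cmod z <= 1 ->
  Csummable (fun n => RtoC (a (S (S n))) * z ^ S (S n))%C.
Proof.
  intros Ha Hz. apply (ex_series_shift2 _ (sqr_summable_Csummable a z Ha Hz)).
Qed.

Lemma Ctail_lipschitz (a : nat -> R) (w z : C) : sqr_summable a -> Cmod w <= 1 -> Cmod z <= 1 ->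
  Cmod (Ctail a w - Ctail a z) <= tail_variation a * Cmod (w - z).
Proof.
  intros Ha Hw Hz. unfold Ctail.
  rewrite <- Cseries_minus by now apply Ctail_summable.
  unfold tail_variation. rewrite <- Series_scal_r. apply Cmod_Cseries_le.
  - intros n. set (m := S (S n)).
    replace (RtoC (a m) * w ^ m - RtoC (a m) * z ^ m)%C
      with (RtoC (a m) * (w ^ m - z ^ m))%C by ring.
    rewrite Cmod_mult, Cmod_R.
    pose proof (Cmod_pow_minus_le w z m Hw Hz). pose proof (Rabs_pos (a m)). nra.
  - apply ex_series_scal_r, (ex_series_shift2 _ (sqr_summable_INR_mult a Ha)).
Qed.

Lemma Ctail_minus_le (a b : nat -> R) (z : C) : sqr_summable a -> sqr_summable b -> Cmod z <= 1 ->
  Cmod (Ctail b z - Ctail a z)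
  <= Series (fun n => Rabs (b (S (S n)) - a (S (S n)))) * Cmod z.
Proof.
  intros Ha Hb Hz. unfold Ctail.
  rewrite <- Cseries_minus by now apply Ctail_summable.
  rewrite <- Series_scal_r. apply Cmod_Cseries_le.
  - intros n. set (m := S (S n)).
    replace (RtoC (b m) * z ^ m - RtoC (a m) * z ^ m)%C
      with (RtoC (b m - a m) * (z * z ^ S n))%C
      by (rewrite RtoC_minus; unfold m; rewrite !Cpow_S; ring).
    rewrite Rmult_comm. apply Cmod_RtoC_mult_le. rewrite Cmod_mult.
    pose proof (Cmod_pow_le_1 z (S n) Hz). pose proof (Cmod_ge_0 z). nra.
  - apply ex_series_scal_r.
    apply ex_series_Rabs_le with (b := fun n => Rabs (b (S (S n))) + Rabs (a (S (S n)))).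
    + intros n. rewrite Rabs_Rabsolu. apply Rle_trans with (1 := Rabs_triang _ _).
      rewrite Rabs_Ropp. apply Rle_refl.
    + exact (ex_series_plus _ _ (ex_series_shift2 _ (sqr_summable_ex_series_Rabs b Hb))
        (ex_series_shift2 _ (sqr_summable_ex_series_Rabs a Ha))).
Qed.

Lemma tail_variation_nonneg (a : nat -> R) : sqr_summable a -> 0 <= tail_variation a.
Proof.
  intros Ha. apply Series_nonneg.
  - intros n. apply Rmult_le_pos; [apply pos_INR | apply Rabs_pos].
  - exact (ex_series_shift2 _ (sqr_summable_INR_mult a Ha)).
Qed.

Lemma Cpseries_lipschitz (a : nat -> R) (w z : C) :
  sqr_summable a -> Cmod w <= 1 -> Cmod z <= 1 ->
  Cmod (Cpseries a w - Cpseries a z)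
  <= (Rabs (a 1%nat) + tail_variation a) * Cmod (w - z).
Proof.
  intros Ha Hw Hz. rewrite !Cpseries_split by assumption.
  match goal with |- Cmod ?e <= _ =>
    replace e with (RtoC (a 1%nat) * (w - z) + (Ctail a w - Ctail a z))%C by ring end.
  apply Rle_trans with (1 := Cmod_triangle _ _). rewrite Cmod_mult, Cmod_R.
  pose proof (Ctail_lipschitz a w z Ha Hw Hz). lra.
Qed.

Lemma Cpseries_expansive (a : nat -> R) (w z : C) :
  sqr_summable a -> Cmod w <= 1 -> Cmod z <= 1 ->
  (Rabs (a 1%nat) - tail_variation a) * Cmod (w - z)
  <= Cmod (Cpseries a w - Cpseries a z).
Proof.
  intros Ha Hw Hz. rewrite !Cpseries_split by assumption.
  match goal with |- _ <= Cmod ?e => set (t := e) end.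
  assert (H : (RtoC (a 1%nat) * (w - z) = t + - (Ctail a w - Ctail a z))%C)
    by (unfold t; ring).
  apply (f_equal Cmod) in H. rewrite Cmod_mult, Cmod_R in H.
  pose proof (Cmod_triangle t (- (Ctail a w - Ctail a z))) as H1.
  rewrite Cmod_opp in H1. pose proof (Ctail_lipschitz a w z Ha Hw Hz). lra.
Qed.

(** If l were 0, the increment of f would be of second order at u, against the
    linear lower bound. *)
Lemma derivative_nonzero_of_expansive (f : C -> C) (m : R) (u l : C) :
  0 < m -> unit_disc u -> quadratic_remainder f u l ->
  (forall w, unit_disc w -> m * Cmod (w - u) <= Cmod (f w - f u)) ->
  l <> RtoC 0.
Proof.
  unfold unit_disc. intros Hm Hu (M & HM & Hq) He Hl. rewrite Hl in Hq.
  set (t := Rmin ((1 - Cmod u) / 2) (m / (2 * (M + 1)))).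
  assert (Ht1 : t <= (1 - Cmod u) / 2) by apply Rmin_l.
  assert (Ht2 : t <= m / (2 * (M + 1))) by apply Rmin_r.
  assert (Ht : 0 < t).
  { apply Rmin_glb_lt; [lra|]. apply Rdiv_lt_0_compat; lra. }
  set (w := (u + RtoC t)%C).
  assert (Hwu : Cmod (w - u) = t).
  { replace (w - u)%C with (RtoC t) by (unfold w; ring).
    rewrite Cmod_R. apply Rabs_pos_eq. lra. }
  assert (Hw : Cmod w < 1) by (pose proof (Cmod_le_plus_minus u w); lra).
  specialize (Hq w Hw). specialize (He w Hw). rewrite Hwu in *.
  replace (f w - f u - 0 * (w - u))%C with (f w - f u)%C in Hq by ring.
  assert (m <= M * t) by (apply Rmult_le_reg_r with t; lra).
  assert (Ht3 : t * (2 * (M + 1)) <= m).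
  { apply Rle_trans with (m / (2 * (M + 1)) * (2 * (M + 1))); [|right; field; lra].
    apply Rmult_le_compat_r; lra. }
  nra.
Qed.

(** The last hypothesis makes the Newton step at slope a_1 map the closed disc with
    diameter from (1 - 2 delta) z to z into itself.  There it is a contraction with
    constant 1/2, because dropping the second sum of that hypothesis leaves twice
    the tail variation at most |a_1|; this also makes the series a injective. *)
Lemma subordinate_Cpseries (a b : nat -> R) (delta : R) :
  sqr_summable a -> sqr_summable b -> 0 < delta <= 1 -> a 1%nat <> 0 ->
  b 0%nat = a 0%nat -> b 1%nat = (1 - delta) * a 1%nat ->
  2 * delta * tail_variation a + Series (fun n => Rabs (b (S (S n)) - a (S (S n))))
    <= delta * Rabs (a 1%nat) ->
  subordinate (Cpseries b) (Cpseries a).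
Proof.
  intros Ha Hb Hdelta Ha1 Hb0 Hb1 Hsmall.
  set (E := Series (fun n => Rabs (b (S (S n)) - a (S (S n))))) in *.
  pose proof (tail_variation_nonneg a Ha) as HL.
  pose proof (tail_variation_nonneg b Hb) as HLb.
  set (L := tail_variation a) in *.
  assert (HE : 0 <= E).
  { pose proof (Ctail_minus_le a b (RtoC 1) Ha Hb) as H. rewrite Cmod_1 in H.
    specialize (H (Rle_refl 1)). pose proof (Cmod_ge_0 (Ctail b 1 - Ctail a 1)).
    fold E in H. lra. }
  assert (Ha1p : 0 < Rabs (a 1%nat)) by now apply Rabs_pos_lt.
  assert (HL2 : 2 * L <= Rabs (a 1%nat)).
  { apply Rmult_le_reg_l with delta; lra. }
  assert (Ha1C : RtoC (a 1%nat) <> RtoC 0) by (intros H; apply Ha1; now apply RtoC_inj).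
  assert (Hfix : forall z, {w : C | unit_disc z ->
            Cmod w <= Cmod z /\ Cpseries a w = Cpseries b z}).
  { intros z. destruct (Rlt_dec (Cmod z) 1) as [Hz|Hz].
    2: { exists (RtoC 0). intros H. now destruct Hz. }
    assert (Hz1 : Cmod z <= 1) by lra. pose proof (Cmod_ge_0 z) as Hz0.
    set (c := (RtoC (1 - delta) * z)%C).
    assert (Hc : Cmod c = (1 - delta) * Cmod z).
    { unfold c. rewrite Cmod_mult, Cmod_R, Rabs_pos_eq; lra. }
    assert (Hcz : Cmod (c - z) = delta * Cmod z).
    { replace (c - z)%C with (RtoC (- delta) * z)%C
        by (unfold c; rewrite RtoC_minus, RtoC_opp; ring).
      rewrite Cmod_mult, Cmod_R, Rabs_Ropp, Rabs_pos_eq; lra. }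
    assert (Hin : forall w, Cmod (w - c) <= delta * Cmod z -> Cmod w <= Cmod z).
    { intros w Hw. pose proof (Cmod_le_plus_minus c w). lra. }
    (* The Newton step for Cpseries a w = Cpseries b z, with the slope at 0. *)
    set (phi := fun w => (w - (Cpseries a w - Cpseries b z) / RtoC (a 1%nat))%C).
    destruct (contraction_fixed_point phi c (delta * Cmod z) (1 / 2))
      as (w & Hw & Hphi).
    - apply Rmult_le_pos; lra.
    - lra.
    - intros w Hw. pose proof (Hin w Hw) as Hwz.
      replace (phi w - c)%C
        with (((Ctail b z - Ctail a z) + (Ctail a z - Ctail a w)) / RtoC (a 1%nat))%C.
      2: { unfold phi, c. rewrite !Cpseries_split, Hb0, Hb1, RtoC_mult by (trivial; lra).
           field. exact Ha1C. }
      rewrite Cmod_div, Cmod_R by exact Ha1C.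
      apply Rle_div_l; [exact Ha1p|].
      apply Rle_trans with (1 := Cmod_triangle _ _).
      pose proof (Ctail_minus_le a b z Ha Hb Hz1) as H1. fold E in H1.
      pose proof (Ctail_lipschitz a z w Ha Hz1 ltac:(lra)) as H2. fold L in H2.
      (* The point z itself lies on the boundary of the disc of centre c. *)
      assert (H3 : Cmod (z - w) <= 2 * delta * Cmod z).
      { replace (z - w)%C with (- (c - z) + - (w - c))%C by ring.
        apply Rle_trans with (1 := Cmod_triangle _ _). rewrite !Cmod_opp. lra. }
      assert (H4 : L * Cmod (z - w) <= L * (2 * delta * Cmod z))
        by now apply Rmult_le_compat_l.
      assert (H5 : (2 * delta * L + E) * Cmod z <= delta * Rabs (a 1%nat) * Cmod z)
        by now apply Rmult_le_compat_r.
      lra.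
    - intros v w Hv Hw. pose proof (Hin v Hv) as Hvz. pose proof (Hin w Hw) as Hwz.
      replace (phi v - phi w)%C with (- ((Ctail a v - Ctail a w) / RtoC (a 1%nat)))%C.
      2: { unfold phi. rewrite !Cpseries_split by (trivial; lra). field. exact Ha1C. }
      rewrite Cmod_opp, Cmod_div, Cmod_R by exact Ha1C.
      apply Rle_div_l; [exact Ha1p|].
      pose proof (Ctail_lipschitz a v w Ha ltac:(lra) ltac:(lra)) as H1. fold L in H1.
      assert (2 * L * Cmod (v - w) <= Rabs (a 1%nat) * Cmod (v - w))
        by (apply Rmult_le_compat_r; [apply Cmod_ge_0 | exact HL2]).
      lra.
    - exists w. intros _. split; [now apply Hin|].
      apply Ceq_minus.
      transitivity (RtoC (a 1%nat) * (w - phi w))%C.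
      + unfold phi. field. exact Ha1C.
      + rewrite Hphi. ring. }
  set (omega := fun z => proj1_sig (Hfix z)).
  assert (Hom : forall z, unit_disc z ->
            Cmod (omega z) <= Cmod z /\ Cpseries a (omega z) = Cpseries b z).
  { intros z. exact (proj2_sig (Hfix z)). }
  assert (Hdisc : forall z, unit_disc z -> unit_disc (omega z)).
  { intros z Hz. unfold unit_disc in *. pose proof (proj1 (Hom z Hz)). lra. }
  split; [now apply Cpseries_analytic|]. split; [now apply Cpseries_analytic|].
  exists omega. split; [|split; [exact Hdisc|split]].
  - intros z Hz.
    pose proof (Hdisc z Hz) as Hoz.
    pose proof (Cpseries_quadratic_remainder a _ Ha Hoz) as Hqa.
    pose proof (Cpseries_quadratic_remainder b z Hb Hz) as Hqb.
    set (l1 := Cseries _) in Hqa. set (l2 := Cseries _) in Hqb.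
    set (m := Rabs (a 1%nat) - L).
    assert (Hm : 0 < m) by (unfold m; lra).
    assert (Hexp : forall w, unit_disc w ->
      m * Cmod (w - omega z) <= Cmod (Cpseries a w - Cpseries a (omega z))).
    { intros w Hw. apply Cpseries_expansive; trivial; now apply Rlt_le. }
    pose proof (derivative_nonzero_of_expansive _ m _ l1 Hm Hoz Hqa Hexp) as Hl1.
    pose proof (proj1 (Cmod_gt_0 l1) Hl1) as Hl1p.
    destruct Hqa as (M1 & HM1 & Hqa). destruct Hqb as (M2 & HM2 & Hqb).
    set (K := Rabs (b 1%nat) + tail_variation b).
    assert (HK : 0 <= K) by (unfold K; pose proof (Rabs_pos (b 1%nat)); lra).
    apply ex_derive_quadratic_remainder with (l := (l2 / l1)%C); [exact Hz|].
    assert (HKm : 0 <= K / m) by (apply Rdiv_le_0_compat; lra).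
    exists ((M2 + M1 * (K / m * (K / m))) / Cmod l1). split.
    { apply Rdiv_le_0_compat; [|exact Hl1p].
      apply Rplus_le_le_0_compat; [exact HM2|].
      apply Rmult_le_pos; [exact HM1|]. now apply Rmult_le_pos. }
    intros w Hw. specialize (Hqb w Hw). specialize (Hqa _ (Hdisc w Hw)).
    specialize (Hexp _ (Hdisc w Hw)).
    rewrite (proj2 (Hom w Hw)), (proj2 (Hom z Hz)) in Hqa, Hexp.
    pose proof (Cpseries_lipschitz b w z Hb (Rlt_le _ _ Hw) (Rlt_le _ _ Hz)) as Hlip.
    fold K in Hlip.
    set (h := Cmod (w - z)) in *. set (o := (omega w - omega z)%C) in *.
    assert (Ho : Cmod o <= K / m * h).
    { apply Rmult_le_reg_l with (1 := Hm). apply Rle_trans with (K * h); [lra|].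
      right. field. lra. }
    assert (Hoo : Cmod o * Cmod o <= K / m * h * (K / m * h))
      by (apply Rmult_le_compat; trivial; apply Cmod_ge_0).
    (* Both remainders are expansions of the same increment of Cpseries b, so their
       difference no longer contains it. *)
    replace (o - l2 / l1 * (w - z))%C
      with (((Cpseries b w - Cpseries b z - l2 * (w - z))
             + - (Cpseries b w - Cpseries b z - l1 * o)) / l1)%C
      by (field; exact Hl1).
    rewrite Cmod_div by exact Hl1. unfold Rdiv at 2. rewrite Rmult_assoc.
    rewrite (Rmult_comm (/ Cmod l1)), <- Rmult_assoc.
    apply Rmult_le_compat_r; [apply Rlt_le, Rinv_0_lt_compat; exact Hl1p|].
    apply Rle_trans with (1 := Cmod_triangle _ _). rewrite Cmod_opp.
    assert (M1 * (Cmod o * Cmod o) <= M1 * (K / m * h * (K / m * h)))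
      by now apply Rmult_le_compat_l.
    lra.
  - assert (H0 : unit_disc (RtoC 0)) by (unfold unit_disc; rewrite Cmod_0; lra).
    destruct (Hom _ H0) as [H _]. rewrite Cmod_0 in H.
    apply Cmod_eq_0, Rle_antisym; [exact H | apply Cmod_ge_0].
  - intros z Hz. symmetry. now apply Hom.
Qed.

(** * The coefficients of the hypergeometric series *)

Definition coef (nu : R) (n : nat) : R :=
  pochhammer (nu + 1 / 2) n
  / (pochhammer (nu + 2) n * pochhammer (2 * nu + 1) n * INR (fact n)).

(** The factor n + 1 of the ratio of consecutive coefficients is left out: it does
    not depend on nu and cancels in comparisons between two parameters. *)
Definition coef_ratio (nu : R) (n : nat) : R :=
  (nu + 1 / 2 + INR n) / ((nu + 2 + INR n) * (2 * nu + 1 + INR n)).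

Lemma pochhammer_pos (a : R) (n : nat) : 0 < a -> 0 < pochhammer a n.
Proof.
  intros Ha. induction n as [|n IH]; simpl; [lra|].
  pose proof (pos_INR n). apply Rmult_lt_0_compat; lra.
Qed.

Lemma INR_fact_S (n : nat) : INR (fact (S n)) = (INR n + 1) * INR (fact n).
Proof. change (fact (S n)) with (S n * fact n)%nat. now rewrite mult_INR, S_INR. Qed.

Lemma coef_S (nu : R) (n : nat) : 0 <= nu ->
  coef nu (S n) = coef nu n * (coef_ratio nu n / (INR n + 1)).
Proof.
  intros Hnu. unfold coef, coef_ratio. rewrite INR_fact_S. simpl pochhammer.
  pose proof (pochhammer_pos (nu + 2) n ltac:(lra)).
  pose proof (pochhammer_pos (2 * nu + 1) n ltac:(lra)).
  pose proof (INR_fact_lt_0 n). pose proof (pos_INR n).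
  field. repeat split; lra.
Qed.

Lemma coef_pos (nu : R) (n : nat) : 0 <= nu -> 0 < coef nu n.
Proof.
  intros Hnu. unfold coef.
  apply Rdiv_lt_0_compat; [apply pochhammer_pos; lra|].
  repeat apply Rmult_lt_0_compat; try (apply pochhammer_pos; lra). apply INR_fact_lt_0.
Qed.

Lemma coef_1 (nu : R) : 0 <= nu -> coef nu 1 = / (2 * (nu + 2)).
Proof. intros Hnu. unfold coef. simpl. field. lra. Qed.

Definition signed_coef (nu : R) (n : nat) : R := (-1) ^ n * coef nu n.

Lemma Rabs_signed (n : nat) (x : R) : Rabs ((-1) ^ n * x) = Rabs x.
Proof.
  rewrite Rabs_mult, <- RPow_abs, Rabs_m1, pow1. apply Rmult_1_l.
Qed.

Lemma F_Cpseries (nu : R) (z : C) : F nu z = Cpseries (signed_coef nu) z.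
Proof.
  unfold F, hyp1F2, Cpseries. apply Cseries_ext. intros n.
  change (RtoC (coef nu n) * (- z) ^ n = RtoC (signed_coef nu n) * z ^ n)%C.
  unfold signed_coef. replace (- z)%C with (RtoC (-1) * z)%C by ring.
  rewrite Cpow_mult_l, <- RtoC_pow, RtoC_mult. ring.
Qed.

Lemma coef_ratio_pos (nu : R) (n : nat) : 0 <= nu -> 0 < coef_ratio nu n.
Proof.
  intros Hnu. pose proof (pos_INR n). unfold coef_ratio.
  apply Rdiv_lt_0_compat; [lra|]. apply Rmult_lt_0_compat; lra.
Qed.

(** With m = n + 2, the weight 4 m - 1 = 2 m + (2 m - 1) adds the 2 m of the
    Lipschitz constant and the 2 m - 1 of [coef_difference].  The constant
    7/8 is the value of 7 c_2/c_1 at nu = 0, and 1/8 is the largest ratio for which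
    the right-hand side still sums to at most c_1.  The ratio of consecutive left-hand sides
    is at most 1/8 because it is (11/7)(5/72) at nu = 0 and n = 0, its worst case. *)
Lemma weighted_coef_le (nu : R) (n : nat) : 0 <= nu ->
  (4 * INR n + 7) * coef nu (S (S n)) <= 7 / 8 * coef nu 1 * (1 / 8) ^ n.
Proof.
  intros Hnu. pose proof (coef_pos nu 1 Hnu) as Hc1.
  induction n as [|n IH].
  - rewrite (coef_S nu 1 Hnu). unfold coef_ratio. simpl INR. simpl pow.
    set (c1 := coef nu 1) in *.
    assert (H : (nu + 1 / 2 + 1) / ((nu + 2 + 1) * (2 * nu + 1 + 1)) / (1 + 1) <= 1 / 8).
    { apply Rle_div_l; [lra|]. apply Rle_div_l; [nra|]. nra. }
    nra.
  - rewrite (coef_S nu (S (S n)) Hnu).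
    pose proof (coef_pos nu (S (S n)) Hnu) as Hc.
    set (c := coef nu (S (S n))) in *. rewrite !S_INR.
    pose proof (pos_INR n) as Hn.
    assert (H : (4 * (INR n + 1) + 7) * (coef_ratio nu (S (S n)) / (INR n + 1 + 1 + 1))
                <= (4 * INR n + 7) / 8).
    { unfold coef_ratio. rewrite !S_INR.
      set (x := INR n) in *.
      replace ((4 * (x + 1) + 7) * ((nu + 1 / 2 + (x + 1 + 1))
               / ((nu + 2 + (x + 1 + 1)) * (2 * nu + 1 + (x + 1 + 1))) / (x + 1 + 1 + 1)))
        with ((4 * x + 11) * (nu + x + 5 / 2) / ((nu + x + 4) * (2 * nu + x + 3) * (x + 3)))
        by (field; repeat split; lra).
      apply Rle_div_l; [repeat apply Rmult_lt_0_compat; lra|].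
      assert (0 <= nu * x) by nra. assert (0 <= x * x) by nra.
      assert (0 <= nu * nu) by nra. assert (0 <= nu * x * x) by nra.
      assert (0 <= nu * nu * x) by nra. assert (0 <= x * x * x) by nra.
      assert (0 <= nu * nu * x * x) by nra. assert (0 <= nu * x * x * x) by nra.
      assert (0 <= x * x * x * x) by nra.
      lra. }
    change ((1 / 8) ^ S n) with (1 / 8 * (1 / 8) ^ n).
    apply Rle_trans with (c * ((4 * INR n + 7) / 8)); [|lra].
    apply Rle_trans with
      (c * ((4 * (INR n + 1) + 7) * (coef_ratio nu (S (S n)) / (INR n + 1 + 1 + 1))));
      [right; ring|].
    apply Rmult_le_compat_l; lra.
Qed.

Lemma ex_series_weights (nu : R) :
  ex_series (fun n => 7 / 8 * coef nu 1 * (1 / 8) ^ n).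
Proof.
  apply ex_series_mult_l, ex_series_geom. rewrite Rabs_pos_eq; lra.
Qed.

Lemma Series_weights (nu : R) :
  Series (fun n => 7 / 8 * coef nu 1 * (1 / 8) ^ n) = coef nu 1.
Proof.
  rewrite Series_scal_l, Series_geom by (rewrite Rabs_pos_eq; lra). field.
Qed.

Lemma sqr_le_pow4 (n : nat) : INR n ^ 2 <= 4 ^ n.
Proof.
  destruct n as [|n]; [simpl; lra|]. induction n as [|n IH]; [simpl; lra|].
  rewrite (S_INR (S n)). change (4 ^ S (S n)) with (4 * 4 ^ S n).
  assert (1 <= INR (S n)) by (rewrite S_INR; pose proof (pos_INR n); lra). nra.
Qed.

Lemma signed_coef_sqr_summable (nu : R) : 0 <= nu -> sqr_summable (signed_coef nu).
Proof.
  intros Hnu. unfold sqr_summable. rewrite (ex_series_incr_n _ 2).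
  apply ex_series_Rabs_le with (b := fun n => 64 * coef nu 1 * (1 / 2) ^ n).
  2: { apply ex_series_mult_l, ex_series_geom. rewrite Rabs_pos_eq; lra. }
  intros n. simpl Nat.add.
  pose proof (weighted_coef_le nu n Hnu) as H.
  pose proof (sqr_le_pow4 (S (S (S n)))) as H4.
  pose proof (coef_pos nu 1 Hnu) as Hc1. pose proof (coef_pos nu (S (S n)) Hnu) as Hc.
  rewrite Rabs_mult, Rabs_Rabsolu. unfold signed_coef.
  rewrite Rabs_signed, (Rabs_pos_eq (coef nu (S (S n)))) by lra.
  rewrite (Rabs_pos_eq (INR (S (S (S n))) ^ 2)) by apply pow2_ge_0.
  replace (1 / 2) with (4 * (1 / 8)) by field. rewrite Rpow_mult_distr.
  change (4 ^ S (S (S n))) with (4 * (4 * (4 * 4 ^ n))) in H4.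
  assert (H8 : 0 < (1 / 8) ^ n) by (apply pow_lt; lra).
  assert (coef nu (S (S n)) <= coef nu 1 * (1 / 8) ^ n).
  { pose proof (pos_INR n). nra. }
  apply Rle_trans with (4 * (4 * (4 * 4 ^ n)) * (coef nu 1 * (1 / 8) ^ n)); [|right; ring].
  apply Rmult_le_compat; try lra. apply pow2_ge_0.
Qed.

(** The quotient of the two ratios factors as (1 - A)(1 - B) with A and B between
    0 and delta = (p - q)/(p + 2).  Here B compares the factors nu + 2 + n, and A
    compares the quotients (2 nu + 1 + 2 n)/(2 nu + 1 + n). *)
Lemma coef_ratio_le (p q : R) (n : nat) : 0 <= q -> q < p ->
  coef_ratio p n <= coef_ratio q n
  /\ (1 - 2 * ((p - q) / (p + 2))) * coef_ratio q n <= coef_ratio p n.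
Proof.
  intros Hq Hpq. pose proof (pos_INR n) as Hn.
  set (d := (p - q) / (p + 2)).
  set (A := 2 * INR n * (p - q) / ((2 * p + 1 + INR n) * (2 * q + 1 + 2 * INR n))).
  set (B := (p - q) / (p + 2 + INR n)).
  pose proof (coef_ratio_pos q n Hq) as Ht.
  assert (Hden : 0 < (2 * p + 1 + INR n) * (2 * q + 1 + 2 * INR n))
    by (apply Rmult_lt_0_compat; lra).
  assert (Heq : coef_ratio p n = (1 - A) * (1 - B) * coef_ratio q n).
  { unfold coef_ratio, A, B. field. repeat split; lra. }
  assert (HA0 : 0 <= A).
  { apply Rdiv_le_0_compat; [|exact Hden]. apply Rmult_le_pos; lra. }
  assert (HB0 : 0 <= B) by (apply Rdiv_le_0_compat; lra).
  assert (HBd : B <= d).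
  { unfold B, d, Rdiv. apply Rmult_le_compat_l; [lra|].
    apply Rinv_le_contravar; lra. }
  assert (HAd : A <= d).
  { unfold A, d. apply Rle_div_l; [exact Hden|].
    replace ((p - q) / (p + 2) * ((2 * p + 1 + INR n) * (2 * q + 1 + 2 * INR n)))
      with ((p - q) * (((2 * p + 1 + INR n) * (2 * q + 1 + 2 * INR n)) / (p + 2)))
      by (field; lra).
    rewrite (Rmult_comm (2 * INR n)). apply Rmult_le_compat_l; [lra|].
    apply (Rle_div_r (2 * INR n)); [lra|].
    assert (Hn' : INR n = 0 \/ 1 <= INR n).
    { destruct n; [now left | right; rewrite S_INR; pose proof (pos_INR n); lra]. }
    destruct Hn' as [H0 | Hn']; [rewrite H0 in *; lra|].
    assert (0 <= p * INR n) by nra. assert (0 <= q * INR n) by nra.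
    assert (0 <= p * q) by nra. nra. }
  assert (Hd1 : d <= 1) by (apply Rle_div_l; lra).
  assert (HAB0 : 0 <= A * B) by now apply Rmult_le_pos.
  assert (HAB : A * B <= 1 * B) by (apply Rmult_le_compat_r; lra).
  rewrite Heq. split.
  - rewrite <- (Rmult_1_l (coef_ratio q n)) at 2.
    apply Rmult_le_compat_r; lra.
  - apply Rmult_le_compat_r; lra.
Qed.

(** A product of factors in [0, 1], one of them equal to 1 - delta and n of them at
    least 1 - 2 delta, is at least 1 - (2 n + 1) delta. *)
Lemma coef_difference (p q : R) (n : nat) : 0 <= q -> q < p ->
  0 <= coef q (S n) - coef p (S n)
    <= (2 * INR n + 1) * ((p - q) / (p + 2)) * coef q (S n).
Proof.
  intros Hq Hpq. set (d := (p - q) / (p + 2)).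
  induction n as [|n IH].
  - rewrite !coef_1 by lra. simpl INR.
    assert (H : / (2 * (q + 2)) - / (2 * (p + 2)) = d * / (2 * (q + 2)))
      by (unfold d; field; lra).
    rewrite H. assert (0 <= d) by (apply Rdiv_le_0_compat; lra).
    assert (0 < / (2 * (q + 2))) by (apply Rinv_0_lt_compat; lra). split; nra.
  - rewrite (coef_S q (S n)), (coef_S p (S n)) by lra.
    destruct (coef_ratio_le p q (S n) Hq Hpq) as [H1 H2]. fold d in H2.
    pose proof (coef_pos p (S n) ltac:(lra)) as Hcp.
    pose proof (coef_pos q (S n) Hq) as Hcq.
    pose proof (coef_ratio_pos p (S n) ltac:(lra)) as Htp.
    pose proof (coef_ratio_pos q (S n) Hq) as Htq.
    set (cp := coef p (S n)) in *. set (cq := coef q (S n)) in *.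
    set (tp := coef_ratio p (S n)) in *. set (tq := coef_ratio q (S n)) in *.
    assert (Hk : 0 < / (INR (S n) + 1))
      by (apply Rinv_0_lt_compat; pose proof (pos_INR (S n)); lra).
    set (k := / (INR (S n) + 1)) in *.
    replace (cq * (tq / (INR (S n) + 1)) - cp * (tp / (INR (S n) + 1)))
      with (((cq - cp) * tq + cp * (tq - tp)) * k) by (unfold k, Rdiv; ring).
    replace ((2 * INR (S n) + 1) * d * (cq * (tq / (INR (S n) + 1))))
      with (((2 * INR n + 1) * d * cq * tq + cq * (2 * d * tq)) * k)
      by (unfold k, Rdiv; rewrite (S_INR n); ring).
    split.
    + apply Rmult_le_pos; [|lra].
      apply Rplus_le_le_0_compat; apply Rmult_le_pos; lra.
    + apply Rmult_le_compat_r; [lra|].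
      apply Rplus_le_compat; [apply Rmult_le_compat_r; lra|].
      apply Rmult_le_compat; lra.
Qed.

Lemma subordinate_ext (f f' g g' : C -> C) : (forall z, f z = f' z) ->
  (forall z, g z = g' z) -> subordinate f' g' -> subordinate f g.
Proof.
  intros Hf Hg (Af & Ag & omega & Ao & Hd & H0 & Ho).
  split; [|split].
  - intros z Hz. eapply ex_derive_ext; [|exact (Af z Hz)]. intros t. now rewrite Hf.
  - intros z Hz. eapply ex_derive_ext; [|exact (Ag z Hz)]. intros t. now rewrite Hg.
  - exists omega. split; [exact Ao|]. split; [exact Hd|]. split; [exact H0|].
    intros z Hz. rewrite Hf, Hg. now apply Ho.
Qed.

Lemma subordinate_F (p q : R) : 0 <= q -> q < p -> subordinate (F p) (F q).
Proof.
  intros Hq Hpq.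
  apply subordinate_ext with (1 := F_Cpseries p) (2 := F_Cpseries q).
  pose proof (coef_pos q 1 Hq) as Hc1.
  set (d := (p - q) / (p + 2)).
  assert (Hd : 0 < d <= 1).
  { split; [apply Rdiv_lt_0_compat; lra | apply Rle_div_l; lra]. }
  pose proof (signed_coef_sqr_summable q Hq) as Rq.
  pose proof (signed_coef_sqr_summable p ltac:(lra)) as Rp.
  apply subordinate_Cpseries with (delta := d); trivial.
  - unfold signed_coef. simpl. lra.
  - unfold signed_coef. rewrite !coef_1 by lra. unfold d. simpl. field. lra.
  - change (signed_coef q 1) with ((-1) ^ 1 * coef q 1).
    rewrite Rabs_signed, (Rabs_pos_eq (coef q 1)) by lra.
    unfold tail_variation. rewrite <- !Series_scal_l, <- Series_plus.
    + rewrite <- (Series_weights q). rewrite <- Series_scal_l. apply Series_le.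
      2: apply ex_series_mult_l, ex_series_weights.
      intros n. split.
      { apply Rplus_le_le_0_compat; [|apply Rabs_pos].
        apply Rmult_le_pos; [lra|]. apply Rmult_le_pos; [apply pos_INR | apply Rabs_pos]. }
      unfold signed_coef. rewrite <- Rmult_minus_distr_l, !Rabs_signed.
      pose proof (coef_pos q (S (S n)) Hq) as Hc.
      rewrite (Rabs_pos_eq (coef q (S (S n)))) by lra.
      destruct (coef_difference p q (S n) Hq Hpq) as [D1 D2]. fold d in D2.
      rewrite Rabs_minus_sym, Rabs_pos_eq by exact D1.
      pose proof (weighted_coef_le q n Hq) as W. rewrite !S_INR in *.
      apply Rmult_le_compat_l with (r := d) in W; [|lra]. lra.
    + apply ex_series_mult_l. exact (ex_series_shift2 _ (sqr_summable_INR_mult _ Rq)).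
    + apply ex_series_Rabs_le with
        (b := fun n => Rabs (signed_coef p (S (S n))) + Rabs (signed_coef q (S (S n)))).
      * intros n. rewrite Rabs_Rabsolu. apply Rle_trans with (1 := Rabs_triang _ _).
        rewrite Rabs_Ropp. apply Rle_refl.
      * exact (ex_series_plus _ _ (ex_series_shift2 _ (sqr_summable_ex_series_Rabs _ Rp))
          (ex_series_shift2 _ (sqr_summable_ex_series_Rabs _ Rq))).
Qed.

(** * The reciprocal Gamma function *)

(** The sequence in Gauss's formula for 1/Gamma(x). *)
Definition gauss_quotient (x : R) (n : nat) : R :=
  pochhammer x (S n) / (INR (fact n) * Rpower (INR n) x).

Lemma Rpower_pos (x y : R) : 0 < Rpower x y.
Proof. apply exp_pos. Qed.

Lemma exp_le (x y : R) : x <= y -> exp x <= exp y.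
Proof. intros [H | ->]; [now apply Rlt_le, exp_increasing | apply Rle_refl]. Qed.

Lemma ln_le_minus_1 (y : R) : 0 < y -> ln y <= y - 1.
Proof.
  intros Hy. pose proof (exp_ineq1_le (ln y)) as H. rewrite exp_ln in H by exact Hy. lra.
Qed.

Lemma Rpower_succ_ge (x m : R) : 0 < x -> 0 < m ->
  Rpower m x * (1 + x / (m + 1)) <= Rpower (m + 1) x.
Proof.
  intros Hx Hm.
  assert (H1 : ln m <= ln (m + 1) - / (m + 1)).
  { pose proof (ln_le_minus_1 (m / (m + 1)) ltac:(apply Rdiv_lt_0_compat; lra)) as H.
    rewrite ln_div in H by lra.
    replace (m / (m + 1) - 1) with (- / (m + 1)) in H by (field; lra). lra. }
  apply Rle_trans with (Rpower m x * exp (x / (m + 1))).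
  - apply Rmult_le_compat_l; [apply Rlt_le, Rpower_pos | apply exp_ineq1_le].
  - unfold Rpower. rewrite <- exp_plus. apply exp_le. unfold Rdiv. nra.
Qed.

(** Bernoulli's inequality for exponents in [0, 1], from the concavity of ln: the
    bound ln y <= y - 1 is averaged with weights x and 1 - x over y = (1 + v)/m and
    y = 1/m, where m = 1 + x v. *)
Lemma Rpower_bernoulli (x v : R) : 0 <= x <= 1 -> 0 <= v -> Rpower (1 + v) x <= 1 + x * v.
Proof.
  intros Hx Hv. set (m := 1 + x * v). assert (Hm : 0 < m) by (unfold m; nra).
  rewrite <- (exp_ln m Hm). unfold Rpower. apply exp_le.
  pose proof (ln_le_minus_1 ((1 + v) / m) ltac:(apply Rdiv_lt_0_compat; lra)) as H1.
  pose proof (ln_le_minus_1 (/ m) ltac:(now apply Rinv_0_lt_compat)) as H2.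
  rewrite ln_div in H1 by lra. rewrite ln_Rinv in H2 by exact Hm.
  assert (H3 : x * ((1 + v) / m - 1) + (1 - x) * (/ m - 1) = 0)
    by (unfold m in *; field; lra).
  nra.
Qed.

Lemma gauss_quotient_pos (x : R) (n : nat) : 0 < x -> 0 < gauss_quotient x n.
Proof.
  intros Hx. apply Rdiv_lt_0_compat; [now apply pochhammer_pos|].
  apply Rmult_lt_0_compat; [apply INR_fact_lt_0 | apply Rpower_pos].
Qed.

(** The quotient of consecutive terms is (1 + x/(n+1)) (n/(n+1))^x, at most
    exp (x/(n+1)) exp (-x/(n+1)). *)
Lemma gauss_quotient_decr (x : R) (n : nat) : 0 < x ->
  gauss_quotient x (S (S n)) <= gauss_quotient x (S n).
Proof.
  intros Hx. unfold gauss_quotient. set (m := S n).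
  assert (Hm : 0 < INR m) by (apply lt_0_INR; unfold m; lia).
  rewrite INR_fact_S, (S_INR m).
  change (pochhammer x (S (S m))) with (pochhammer x (S m) * (x + INR (S m))).
  rewrite (S_INR m).
  pose proof (pochhammer_pos x (S m) Hx) as HP.
  pose proof (INR_fact_lt_0 m) as Hf.
  pose proof (Rpower_succ_ge x (INR m) Hx Hm) as H.
  pose proof (Rpower_pos (INR m) x) as Hp1. pose proof (Rpower_pos (INR m + 1) x) as Hp2.
  set (P := pochhammer x (S m)) in *. set (M := INR m) in *. set (f := INR (fact m)) in *.
  set (r := Rpower M x) in *. set (s := Rpower (M + 1) x) in *.
  replace (P * (x + (M + 1)) / ((M + 1) * f * s))
    with (P / (f * r) * (r * (1 + x / (M + 1)) / s)) by (field; repeat split; lra).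
  rewrite <- (Rmult_1_r (P / (f * r))) at 2. apply Rmult_le_compat_l.
  - apply Rlt_le, Rdiv_lt_0_compat; [exact HP | now apply Rmult_lt_0_compat].
  - apply Rle_div_l; lra.
Qed.

(** With (n+1)^x in place of n^x the sequence becomes increasing for x <= 1, by
    Bernoulli's inequality, and its first term is x.  This keeps the limit away
    from 0. *)
Lemma gauss_quotient_ge (x : R) (n : nat) : 0 < x <= 1 -> x <= gauss_quotient x (S n).
Proof.
  intros Hx.
  assert (H : forall m, x * (INR (fact m) * Rpower (INR m + 1) x) <= pochhammer x (S m)).
  { induction m as [|m IH].
    - simpl. rewrite Rplus_0_l. unfold Rpower. rewrite ln_1, Rmult_0_r, exp_0. lra.
    - rewrite INR_fact_S, S_INR.
      change (pochhammer x (S (S m))) with (pochhammer x (S m) * (x + INR (S m))).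
      rewrite S_INR. pose proof (pos_INR m) as Hm. set (M := INR m) in *.
      pose proof (Rpower_bernoulli x (/ (M + 1)) ltac:(lra)
        ltac:(apply Rlt_le, Rinv_0_lt_compat; lra)) as Hb.
      pose proof (Rpower_pos (M + 1) x) as Hp. pose proof (INR_fact_lt_0 m) as Hf.
      assert (Hs : Rpower (M + 1 + 1) x <= Rpower (M + 1) x * (1 + x * / (M + 1))).
      { replace (M + 1 + 1) with ((M + 1) * (1 + / (M + 1))) by (field; lra).
        assert (0 < / (M + 1)) by (apply Rinv_0_lt_compat; lra).
        rewrite <- Rpower_mult_distr by lra. apply Rmult_le_compat_l; lra. }
      apply Rle_trans with (x * (INR (fact m) * Rpower (M + 1) x) * (x + (M + 1))).
      2: { apply Rmult_le_compat_r; lra. }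
      replace (x * (INR (fact m) * Rpower (M + 1) x) * (x + (M + 1)))
        with (x * ((M + 1) * INR (fact m)) * (Rpower (M + 1) x * (1 + x * / (M + 1))))
        by (field; lra).
      rewrite <- Rmult_assoc. apply Rmult_le_compat_l; [|exact Hs].
      apply Rmult_le_pos; [lra|]. apply Rmult_le_pos; lra. }
  unfold gauss_quotient. set (m := S n).
  assert (Hm : 0 < INR m) by (apply lt_0_INR; unfold m; lia).
  pose proof (INR_fact_lt_0 m) as Hf. pose proof (Rpower_pos (INR m) x) as Hp.
  apply (Rle_div_r x); [now apply Rmult_lt_0_compat|].
  apply Rle_trans with (2 := H m). apply Rmult_le_compat_l; [lra|].
  apply Rmult_le_compat_l; [lra|]. apply Rle_Rpower_l; lra.
Qed.

Lemma is_lim_seq_gauss_quotient (x : R) : 0 < x ->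
  is_lim_seq (gauss_quotient x) (rGamma x).
Proof.
  intros Hx. apply Lim_seq_correct'.
  destruct (ex_finite_lim_seq_decr (fun n => gauss_quotient x (S n)) 0) as [l Hl];
    [| |exists l; now apply is_lim_seq_incr_1].
  - intros n. now apply gauss_quotient_decr.
  - intros n. now apply Rlt_le, gauss_quotient_pos.
Qed.

Lemma pochhammer_shift (x : R) (n : nat) : pochhammer x (S n) = x * pochhammer (x + 1) n.
Proof.
  induction n as [|n IH]; [simpl; ring|].
  change (pochhammer x (S (S n))) with (pochhammer x (S n) * (x + INR (S n))).
  rewrite IH, S_INR. simpl. ring.
Qed.

Lemma is_lim_seq_shifted_ratio (c : R) : 0 < c ->
  is_lim_seq (fun n => INR n / (INR n + c)) 1.
Proof.
  intros Hc. apply is_lim_seq_ext with (fun n => 1 - c * / (INR n + c)).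
  { intros n. pose proof (pos_INR n). field. lra. }
  replace 1 with (1 - c * 0) at 1 by ring.
  apply is_lim_seq_minus'; [apply is_lim_seq_const|].
  apply is_lim_seq_mult'; [apply is_lim_seq_const|].
  apply (is_lim_seq_inv _ p_infty); [|discriminate].
  apply is_lim_seq_le_p_loc with INR; [|apply is_lim_seq_INR].
  exists 0%nat. intros n _. lra.
Qed.

(** At x = 0 this says that 1/Gamma vanishes at the pole 0, as needed for the
    Bessel function of order -1. *)
Lemma rGamma_functional (x : R) : 0 <= x -> rGamma x = x * rGamma (x + 1).
Proof.
  intros Hx. destruct (Req_dec x 0) as [->|Hx0].
  { rewrite Rmult_0_l. unfold rGamma.
    rewrite (Lim_seq_ext _ (fun _ => 0)); [now rewrite Lim_seq_const|].
    intros n. rewrite pochhammer_shift. unfold Rdiv. ring. }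
  pose proof (is_lim_seq_gauss_quotient (x + 1) ltac:(lra)) as H1.
  pose proof (is_lim_seq_gauss_quotient x ltac:(lra)) as H0.
  pose proof (is_lim_seq_mult' _ _ _ _ H1 (is_lim_seq_shifted_ratio (x + 1) ltac:(lra))) as H2.
  pose proof (is_lim_seq_mult' _ _ _ _ (is_lim_seq_const x) H2) as H3.
  apply is_lim_seq_unique in H0.
  apply is_lim_seq_ext_loc with (v := gauss_quotient x) in H3.
  - apply is_lim_seq_unique in H3. rewrite H0 in H3. injection H3. intros ->. ring.
  - exists 1%nat. intros n Hn. unfold gauss_quotient.
    assert (Hn' : 0 < INR n) by (apply lt_0_INR; lia).
    rewrite (pochhammer_shift x n), Rpower_plus, Rpower_1 by exact Hn'.
    simpl pochhammer. pose proof (INR_fact_lt_0 n). pose proof (Rpower_pos (INR n) x).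
    field. repeat split; lra.
Qed.

(** The functional equation propagates positivity from (0, 1] to each (0, N + 1]. *)
Lemma rGamma_pos (x : R) : 0 < x -> 0 < rGamma x.
Proof.
  assert (H : forall N y, 0 < y <= INR N + 1 -> 0 < rGamma y).
  { induction N as [|N IH]; intros y Hy.
    - apply Rlt_le_trans with y; [lra|].
      pose proof (is_lim_seq_gauss_quotient y ltac:(lra)) as Hl.
      apply is_lim_seq_incr_1 in Hl.
      apply (is_lim_seq_le (fun _ => y) _ y (rGamma y)
        (fun n => gauss_quotient_ge y n ltac:(simpl in Hy; lra)) (is_lim_seq_const y) Hl).
    - destruct (Rle_dec y 1) as [Hy1|Hy1].
      + apply IH. pose proof (pos_INR N). lra.
      + rewrite S_INR in Hy.
        pose proof (IH (y - 1) ltac:(lra)) as Hp.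
        rewrite rGamma_functional in Hp by lra.
        replace (y - 1 + 1) with y in Hp by ring.
        apply Rmult_lt_reg_l with (y - 1); lra. }
  intros Hx. destruct (nfloor_ex x ltac:(lra)) as [N HN]. apply (H N). lra.
Qed.

Lemma rGamma_shift (x : R) (n : nat) : 0 < x ->
  rGamma (INR n + x) = rGamma x / pochhammer x n.
Proof.
  intros Hx. induction n as [|n IH].
  - simpl. rewrite Rplus_0_l. field.
  - pose proof (pos_INR n). pose proof (pochhammer_pos x n Hx).
    rewrite rGamma_functional in IH by lra. rewrite S_INR.
    replace (INR n + 1 + x) with (INR n + x + 1) by ring.
    apply Rmult_eq_reg_l with (INR n + x); [|lra]. rewrite IH. simpl. field. lra.
Qed.

(** * Generalized binomial coefficients and Vandermonde's identity *)

Fixpoint gbinom (x : R) (n : nat) : R :=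
  match n with
  | O => 1
  | S m => gbinom x m * (x - INR m) / (INR m + 1)
  end.

Lemma gbinom_S (x : R) (n : nat) :
  (INR n + 1) * gbinom x (S n) = (x - INR n) * gbinom x n.
Proof. simpl. field. pose proof (pos_INR n). lra. Qed.

(** Induction on n, without manipulating binomial coefficients of integers: in
    (n + 1) times the convolution of order n + 1, the factor n + 1 is split as
    k + (n + 1 - k), and each part lowers one of the two binomial coefficients. *)
Lemma gbinom_vandermonde (x y : R) (n : nat) :
  conv (gbinom x) (gbinom y) n = gbinom (x + y) n.
Proof.
  induction n as [|n IH]; [unfold conv; simpl; ring|].
  pose proof (pos_INR n) as Hn.
  apply Rmult_eq_reg_l with (INR n + 1); [|lra].
  rewrite gbinom_S, <- IH. unfold conv.
  set (f := fun k => gbinom x k * gbinom y (S n - k)%nat).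
  assert (H : (INR n + 1) * sum_f_R0 f (S n)
     = sum_f_R0 (fun k => INR k * f k) (S n)
       + sum_f_R0 (fun k => (INR n + 1 - INR k) * f k) (S n)).
  { rewrite <- sum_plus, scal_sum. apply sum_eq. intros k _. ring. }
  rewrite H, (decomp_sum _ (S n)) by lia. simpl pred.
  rewrite tech5. change (INR 0) with 0. rewrite S_INR.
  replace (INR n + 1 - (INR n + 1)) with 0 by ring.
  rewrite !Rmult_0_l, Rplus_0_l, Rplus_0_r, <- sum_plus, scal_sum.
  apply sum_eq. intros k Hk. unfold f.
  replace (S n - S k)%nat with (n - k)%nat by lia.
  replace (S n - k)%nat with (S (n - k)) by lia.
  pose proof (gbinom_S x k) as Hx. pose proof (gbinom_S y (n - k)) as Hy.
  rewrite minus_INR in Hy by exact Hk. rewrite S_INR.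
  replace ((INR k + 1) * (gbinom x (S k) * gbinom y (n - k)))
    with ((INR k + 1) * gbinom x (S k) * gbinom y (n - k)) by ring.
  replace ((INR n + 1 - INR k) * (gbinom x k * gbinom y (S (n - k))))
    with (gbinom x k * ((INR n - INR k + 1) * gbinom y (S (n - k)))) by ring.
  rewrite Hx, Hy. ring.
Qed.

Lemma gbinom_pochhammer (a : R) (m n : nat) : (m <= n)%nat ->
  gbinom (a + INR n - 1) m * INR (fact m) * pochhammer a (n - m) = pochhammer a n.
Proof.
  induction m as [|m IH]; intros Hm.
  - rewrite Nat.sub_0_r. simpl. ring.
  - rewrite <- IH by lia. replace (n - m)%nat with (S (n - S m)) by lia.
    rewrite INR_fact_S. simpl gbinom. simpl pochhammer.
    rewrite minus_INR, S_INR by exact Hm. pose proof (pos_INR m). field. lra.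
Qed.

Lemma gbinom_absorb (x : R) (m : nat) :
  x * gbinom (x - 1) m = (x - INR m) * gbinom x m.
Proof.
  induction m as [|m IH]; [simpl; ring|].
  pose proof (pos_INR m) as Hm. pose proof (gbinom_S x m) as H1.
  pose proof (gbinom_S (x - 1) m) as H2. rewrite S_INR.
  apply Rmult_eq_reg_l with (INR m + 1); [|lra].
  transitivity (x * ((INR m + 1) * gbinom (x - 1) (S m))); [ring|].
  rewrite H2. transitivity ((x - 1 - INR m) * (x * gbinom (x - 1) m)); [ring|].
  rewrite IH. transitivity ((x - (INR m + 1)) * ((INR m + 1) * gbinom x (S m))); [|ring].
  rewrite H1. ring.
Qed.

Lemma pochhammer_double (x : R) (n : nat) :
  pochhammer (2 * x) (2 * n) = 4 ^ n * pochhammer x n * pochhammer (x + 1 / 2) n.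
Proof.
  induction n as [|n IH]; [simpl; ring|].
  replace (2 * S n)%nat with (S (S (2 * n))) by lia.
  change (pochhammer (2 * x) (S (S (2 * n)))) with
    (pochhammer (2 * x) (2 * n) * (2 * x + INR (2 * n)) * (2 * x + INR (S (2 * n)))).
  rewrite IH, S_INR, mult_INR. simpl. field.
Qed.

(** * The Turanian as a hypergeometric series *)

Lemma Cpowr_plus (z : C) (a b : R) : Cpowr z (a + b) = (Cpowr z a * Cpowr z b)%C.
Proof.
  unfold Cpowr. rewrite Rpower_plus, Rmult_plus_distr_r, cos_plus, sin_plus.
  unfold Cmult. simpl. f_equal; ring.
Qed.

Lemma Cpowr_0 (z : C) : Cpowr z 0 = RtoC 1.
Proof.
  unfold Cpowr, Rpower. rewrite !Rmult_0_l, exp_0, cos_0, sin_0, Rmult_1_l, Rmult_0_r.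
  reflexivity.
Qed.

(** Halving z does not change its argument, so it commutes with the principal
    branch. *)
Lemma Cpowr_half (z : C) (a : R) : z <> RtoC 0 ->
  Cpowr (z / RtoC 2) a = (RtoC (Rpower (1 / 2) a) * Cpowr z a)%C.
Proof.
  intros Hz. pose proof (proj1 (Cmod_gt_0 z) Hz) as Hm.
  replace (z / RtoC 2)%C with (RtoC (1 / 2) * z)%C
    by (rewrite RtoC_div by lra; field; intros H; apply RtoC_inj in H; lra).
  assert (Harg : Carg (RtoC (1 / 2) * z) = Carg z).
  { unfold Carg. rewrite im_scal_l, re_scal_l, Cmod_mult, Cmod_R, (Rabs_pos_eq (1 / 2)) by lra.
    replace (1 / 2 * Re z / (1 / 2 * Cmod z)) with (Re z / Cmod z) by (field; lra).
    destruct (Rlt_dec (1 / 2 * Im z) 0), (Rlt_dec (Im z) 0); trivial; lra. }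
  unfold Cpowr. rewrite Harg, Cmod_mult, Cmod_R, (Rabs_pos_eq (1 / 2)) by lra.
  rewrite <- Rpower_mult_distr by lra.
  unfold Cmult. simpl. f_equal; ring.
Qed.

Lemma sqr_summable_of_fact (a : nat -> R) (K : R) :
  (forall n, Rabs (a n) <= K / INR (fact n)) -> sqr_summable a.
Proof.
  intros Ha. unfold sqr_summable.
  apply ex_series_Rabs_le with (b := fun n => 4 * K * (/ INR (fact n) * 4 ^ n)).
  - intros n. rewrite Rabs_mult, Rabs_Rabsolu, (Rabs_pos_eq (INR (S n) ^ 2)) by apply pow2_ge_0.
    replace (4 * K * (/ INR (fact n) * 4 ^ n)) with (4 ^ S n * (K / INR (fact n)))
      by (unfold Rdiv; simpl; ring).
    apply Rmult_le_compat; [apply pow2_ge_0 | apply Rabs_pos | apply sqr_le_pow4 | apply Ha].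
  - apply ex_series_mult_l, ex_pseries_R. exists (exp 4). apply is_exp_Reals.
Qed.

(** The Bessel functions of orders nu, nu - 1 and nu + 1 are
    1/Gamma(nu + 1) times (z/2)^mu, mu being the order, times the power series in
    (z/2)^2 with the following coefficients.  For order nu - 1 the factor n + nu in
    the numerator replaces nu/(nu)_n, which is meaningless at nu = 0. *)
Definition bessel_mid (nu : R) (n : nat) : R :=
  (-1) ^ n / (INR (fact n) * pochhammer (nu + 1) n).

Definition bessel_low (nu : R) (n : nat) : R :=
  (-1) ^ n * (INR n + nu) / (INR (fact n) * pochhammer (nu + 1) n).

Definition bessel_high (nu : R) (n : nat) : R :=
  (-1) ^ n / (INR (fact n) * pochhammer (nu + 1) (S n)).

Lemma pochhammer_ge_1 (a : R) (n : nat) : 1 <= a -> 1 <= pochhammer a n.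
Proof.
  intros Ha. induction n as [|n IH]; simpl; [lra|].
  pose proof (pos_INR n). nra.
Qed.

Lemma Rabs_signed_div_fact (n : nat) (x D : R) : 0 < D ->
  Rabs ((-1) ^ n * x / (INR (fact n) * D)) = Rabs x / D / INR (fact n).
Proof.
  intros HD. pose proof (INR_fact_lt_0 n).
  replace ((-1) ^ n * x / (INR (fact n) * D)) with ((-1) ^ n * (x / (INR (fact n) * D)))
    by (field; lra).
  rewrite Rabs_signed, Rabs_div, (Rabs_pos_eq (INR (fact n) * D)) by nra.
  field. lra.
Qed.

Lemma bessel_mid_sqr_summable (nu : R) : 0 <= nu -> sqr_summable (bessel_mid nu).
Proof.
  intros Hnu. apply sqr_summable_of_fact with 1. intros n. unfold bessel_mid.
  pose proof (pochhammer_ge_1 (nu + 1) n ltac:(lra)) as HP.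
  rewrite <- (Rmult_1_r ((-1) ^ n)), Rabs_signed_div_fact, Rabs_R1 by lra.
  apply Rmult_le_compat_r; [apply Rlt_le, Rinv_0_lt_compat, INR_fact_lt_0|].
  apply Rle_div_l; lra.
Qed.

Lemma bessel_high_sqr_summable (nu : R) : 0 <= nu -> sqr_summable (bessel_high nu).
Proof.
  intros Hnu. apply sqr_summable_of_fact with 1. intros n. unfold bessel_high.
  pose proof (pochhammer_ge_1 (nu + 1) (S n) ltac:(lra)) as HP.
  rewrite <- (Rmult_1_r ((-1) ^ n)), Rabs_signed_div_fact, Rabs_R1 by lra.
  apply Rmult_le_compat_r; [apply Rlt_le, Rinv_0_lt_compat, INR_fact_lt_0|].
  apply Rle_div_l; lra.
Qed.

Lemma bessel_low_sqr_summable (nu : R) : 0 <= nu -> sqr_summable (bessel_low nu).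
Proof.
  intros Hnu. apply sqr_summable_of_fact with (nu + 1). intros n. unfold bessel_low.
  pose proof (pochhammer_ge_1 (nu + 1) n ltac:(lra)) as HP.
  pose proof (pos_INR n) as Hn.
  rewrite Rabs_signed_div_fact, Rabs_pos_eq by lra.
  apply Rmult_le_compat_r; [apply Rlt_le, Rinv_0_lt_compat, INR_fact_lt_0|].
  apply Rle_div_l; [lra|]. destruct n as [|n].
  - simpl. lra.
  - pose proof (pochhammer_ge_1 (nu + 1) n ltac:(lra)) as HP'.
    pose proof (pos_INR n). rewrite S_INR.
    change (pochhammer (nu + 1) (S n)) with (pochhammer (nu + 1) n * (nu + 1 + INR n)).
    replace (INR n + 1 + nu) with (1 * (1 * (nu + 1 + INR n))) by ring.
    apply Rmult_le_compat; try lra. apply Rmult_le_compat_r; lra.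
Qed.

Lemma besselJ_Cpseries (mu G : R) (a : nat -> R) (z : C) :
  (forall n, (-1) ^ n * rGamma (INR n + mu + 1) / INR (fact n) = G * a n) ->
  sqr_summable a -> Cmod ((z / RtoC 2) ^ 2) <= 1 ->
  besselJ mu z = (Cpowr (z / RtoC 2) mu * (RtoC G * Cpseries a ((z / RtoC 2) ^ 2)))%C.
Proof.
  intros HG Ha Hz. unfold besselJ, Cpseries. f_equal.
  rewrite <- Cseries_scal by now apply sqr_summable_Csummable.
  apply Cseries_ext. intros n. rewrite HG, Cpow_mult_r, RtoC_mult. ring.
Qed.

Lemma besselJ_mid_coef (nu : R) (n : nat) : 0 <= nu ->
  (-1) ^ n * rGamma (INR n + nu + 1) / INR (fact n) = rGamma (nu + 1) * bessel_mid nu n.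
Proof.
  intros Hnu. rewrite Rplus_assoc, rGamma_shift by lra. unfold bessel_mid.
  pose proof (pochhammer_pos (nu + 1) n ltac:(lra)). pose proof (INR_fact_lt_0 n).
  field. lra.
Qed.

Lemma besselJ_low_coef (nu : R) (n : nat) : 0 <= nu ->
  (-1) ^ n * rGamma (INR n + (nu - 1) + 1) / INR (fact n)
  = rGamma (nu + 1) * bessel_low nu n.
Proof.
  intros Hnu. replace (INR n + (nu - 1) + 1) with (INR n + nu) by ring.
  pose proof (pos_INR n).
  rewrite rGamma_functional, Rplus_assoc, rGamma_shift by lra. unfold bessel_low.
  pose proof (pochhammer_pos (nu + 1) n ltac:(lra)). pose proof (INR_fact_lt_0 n).
  field. lra.
Qed.

Lemma besselJ_high_coef (nu : R) (n : nat) : 0 <= nu ->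
  (-1) ^ n * rGamma (INR n + (nu + 1) + 1) / INR (fact n)
  = rGamma (nu + 1) * bessel_high nu n.
Proof.
  intros Hnu. replace (INR n + (nu + 1) + 1) with (INR (S n) + (nu + 1)) by (rewrite S_INR; ring).
  rewrite rGamma_shift by lra. unfold bessel_high.
  pose proof (pochhammer_pos (nu + 1) (S n) ltac:(lra)). pose proof (INR_fact_lt_0 n).
  field. lra.
Qed.

(** Turns the denominators in the products of Bessel series into binomial
    coefficients, with the common denominator pulled out. *)
Lemma inv_fact_pochhammer (a : R) (m n : nat) : 0 < a -> (m <= n)%nat ->
  / (INR (fact m) * pochhammer a (n - m))
  = gbinom (a + INR n - 1) m / pochhammer a n.
Proof.
  intros Ha Hm. rewrite <- (gbinom_pochhammer a m n Hm).
  pose proof (pochhammer_pos a (n - m) Ha) as H1. pose proof (INR_fact_lt_0 m) as H2.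
  pose proof (gbinom_pochhammer a m n Hm) as H.
  pose proof (pochhammer_pos a n Ha) as H3.
  assert (gbinom (a + INR n - 1) m <> 0) by (intros H0; rewrite H0 in H; nra).
  field. repeat split; lra || assumption.
Qed.

(** The factorials and Pochhammer symbols are paired crosswise: k! goes with
    (nu + 1)_(n-k), so that Vandermonde's identity applies. *)
Lemma conv_mid_mid (nu : R) (n : nat) : 0 <= nu ->
  conv (bessel_mid nu) (bessel_mid nu) n
  = (-1) ^ n * gbinom (2 * nu + 2 * INR n) n / (pochhammer (nu + 1) n * pochhammer (nu + 1) n).
Proof.
  intros Hnu. replace (2 * nu + 2 * INR n) with ((nu + INR n) + (nu + INR n)) by ring.
  rewrite <- gbinom_vandermonde. unfold conv, Rdiv.
  rewrite (Rmult_comm ((-1) ^ n)), Rmult_assoc, Rmult_comm, scal_sum.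
  apply sum_eq. intros k Hk. unfold bessel_mid.
  pose proof (inv_fact_pochhammer (nu + 1) k n ltac:(lra) Hk) as H1.
  pose proof (inv_fact_pochhammer (nu + 1) (n - k) n ltac:(lra) ltac:(lia)) as H2.
  replace (n - (n - k))%nat with k in H2 by lia.
  replace (nu + 1 + INR n - 1) with (nu + INR n) in * by ring.
  replace ((-1) ^ n) with ((-1) ^ k * (-1) ^ (n - k)) by (rewrite <- pow_add; f_equal; lia).
  pose proof (pochhammer_pos (nu + 1) n ltac:(lra)).
  pose proof (pochhammer_pos (nu + 1) k ltac:(lra)).
  pose proof (pochhammer_pos (nu + 1) (n - k) ltac:(lra)).
  pose proof (INR_fact_lt_0 k). pose proof (INR_fact_lt_0 (n - k)).
  transitivity ((-1) ^ k * (-1) ^ (n - k)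
    * (/ (INR (fact k) * pochhammer (nu + 1) (n - k)))
    * (/ (INR (fact (n - k)) * pochhammer (nu + 1) k))); [field; repeat split; lra|].
  rewrite H1, H2. field. lra.
Qed.

(** As for [conv_mid_mid]; the extra factor k + nu turns the binomial coefficient of
    nu + n into n + nu times that of nu + n - 1, by absorption.  The two upper
    arguments then still add up to 2 nu + 2 n. *)
Lemma conv_low_high (nu : R) (n : nat) : 0 <= nu ->
  conv (bessel_low nu) (bessel_high nu) n
  = (-1) ^ n * (INR n + nu) * gbinom (2 * nu + 2 * INR n) n
    / (pochhammer (nu + 1) n * pochhammer (nu + 1) (S n)).
Proof.
  intros Hnu.
  replace (2 * nu + 2 * INR n) with ((nu + INR n + 1) + (nu + INR n - 1)) by ring.
  rewrite <- gbinom_vandermonde. unfold conv at 2. unfold Rdiv.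
  rewrite (Rmult_comm ((-1) ^ n * _)), Rmult_assoc, Rmult_comm, scal_sum.
  apply sum_eq. intros k Hk. unfold bessel_low, bessel_high.
  pose proof (inv_fact_pochhammer (nu + 1) k (S n) ltac:(lra) ltac:(lia)) as H1.
  pose proof (inv_fact_pochhammer (nu + 1) (n - k) n ltac:(lra) ltac:(lia)) as H2.
  pose proof (gbinom_absorb (nu + INR n) (n - k)) as H3.
  rewrite minus_INR in H3 by exact Hk.
  replace (n - (n - k))%nat with k in H2 by lia.
  replace (S n - k)%nat with (S (n - k)) in H1 by lia.
  rewrite S_INR in H1.
  replace (nu + 1 + INR n - 1) with (nu + INR n) in * by ring.
  replace (nu + 1 + (INR n + 1) - 1) with (nu + INR n + 1) in H1 by ring.
  replace ((-1) ^ n) with ((-1) ^ k * (-1) ^ (n - k)) by (rewrite <- pow_add; f_equal; lia).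
  pose proof (pochhammer_pos (nu + 1) n ltac:(lra)).
  pose proof (pochhammer_pos (nu + 1) (S n) ltac:(lra)).
  pose proof (pochhammer_pos (nu + 1) k ltac:(lra)).
  pose proof (pochhammer_pos (nu + 1) (S (n - k)) ltac:(lra)).
  pose proof (INR_fact_lt_0 k). pose proof (INR_fact_lt_0 (n - k)).
  transitivity ((-1) ^ k * (-1) ^ (n - k) * (INR k + nu)
    * (/ (INR (fact k) * pochhammer (nu + 1) (S (n - k))))
    * (/ (INR (fact (n - k)) * pochhammer (nu + 1) k))); [field; repeat split; lra|].
  rewrite H1, H2.
  transitivity ((-1) ^ k * (-1) ^ (n - k) * gbinom (nu + INR n + 1) k
    * ((nu + INR n - (INR n - INR k)) * gbinom (nu + INR n) (n - k))
    / (pochhammer (nu + 1) n * pochhammer (nu + 1) (S n))); [field; lra|].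
  rewrite <- H3. field. lra.
Qed.

(** The two convolutions differ by the factor (n + nu)/(n + nu + 1), so their
    difference is a single product; the binomial coefficient of 2 nu + 2 n is then
    expanded with the duplication formula. *)
Lemma turanian_coefficient (nu : R) (n : nat) : 0 <= nu ->
  (nu + 1) * (conv (bessel_mid nu) (bessel_mid nu) n
              - conv (bessel_low nu) (bessel_high nu) n)
  = 4 ^ n * signed_coef nu n.
Proof.
  intros Hnu. rewrite conv_mid_mid, conv_low_high by exact Hnu.
  unfold signed_coef, coef. pose proof (pos_INR n).
  pose proof (gbinom_pochhammer (2 * nu + 1) n (2 * n) ltac:(lia)) as Hg.
  replace (2 * n - n)%nat with n in Hg by lia. rewrite mult_INR in Hg.
  replace (2 * nu + 1 + INR 2 * INR n - 1) with (2 * nu + 2 * INR n) in Hg by (simpl; ring).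
  pose proof (pochhammer_double (nu + 1 / 2) n) as Hd.
  replace (2 * (nu + 1 / 2)) with (2 * nu + 1) in Hd by field.
  replace (nu + 1 / 2 + 1 / 2) with (nu + 1) in Hd by field.
  rewrite Hd in Hg.
  pose proof (pochhammer_pos (nu + 1) n ltac:(lra)) as P1.
  pose proof (pochhammer_pos (nu + 2) n ltac:(lra)) as P2.
  pose proof (pochhammer_pos (2 * nu + 1) n ltac:(lra)) as P3.
  pose proof (INR_fact_lt_0 n) as Hf.
  assert (Hsh : pochhammer (nu + 1) n * (nu + 1 + INR n) = (nu + 1) * pochhammer (nu + 2) n).
  { change (pochhammer (nu + 1) (S n) = (nu + 1) * pochhammer (nu + 2) n).
    rewrite pochhammer_shift. do 2 f_equal. ring. }
  simpl pochhammer.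
  set (g := gbinom (2 * nu + 2 * INR n) n) in *.
  assert (Hg' : g = 4 ^ n * pochhammer (nu + 1 / 2) n * pochhammer (nu + 1) n
                    / (INR (fact n) * pochhammer (2 * nu + 1) n)).
  { rewrite <- Hg. field. lra. }
  transitivity ((-1) ^ n * g * (nu + 1)
     / (pochhammer (nu + 1) n * (pochhammer (nu + 1) n * (nu + 1 + INR n)))).
  { field. lra. }
  rewrite Hsh, Hg'. field. repeat split; lra.
Qed.

Lemma Cpseries_scale_arg (a : nat -> R) (c : R) (z : C) :
  Cpseries (fun n => c ^ n * a n) z = Cpseries a (RtoC c * z).
Proof.
  apply Cseries_ext. intros n. rewrite Cpow_mult_l, RtoC_mult, RtoC_pow. ring.
Qed.

Lemma Cpseries_minus_scal (a b d : nat -> R) (c : R) (z : C) :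
  Csummable (fun n => RtoC (a n) * z ^ n)%C ->
  Csummable (fun n => RtoC (b n) * z ^ n)%C ->
  (forall n, c * (a n - b n) = d n) ->
  (RtoC c * (Cpseries a z - Cpseries b z))%C = Cpseries d z.
Proof.
  intros Ha Hb Hd. unfold Cpseries.
  rewrite <- Cseries_minus by assumption. rewrite <- Cseries_scal.
  - apply Cseries_ext. intros n. rewrite <- Hd, RtoC_mult, RtoC_minus. ring.
  - apply Csummable_le with (b := fun n => Cmod (RtoC (a n) * z ^ n) + Cmod (RtoC (b n) * z ^ n)).
    + intros n. apply Rle_trans with (1 := Cmod_triangle _ _). rewrite Cmod_opp. lra.
    + exact (ex_series_plus _ _ Ha Hb).
Qed.

(** Dominated by the Cauchy product of the absolute values. *)
Lemma conv_Csummable (a b : nat -> R) (z : C) : sqr_summable a -> sqr_summable b -> Cmod z <= 1 ->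
  Csummable (fun n => RtoC (conv a b n) * z ^ n)%C.
Proof.
  intros Ha Hb Hz.
  pose proof (sqr_summable_ex_series_Rabs a Ha) as Sa. pose proof (sqr_summable_ex_series_Rabs b Hb) as Sb.
  apply Csummable_le with (b := conv (fun k => Rabs (a k)) (fun k => Rabs (b k))).
  - intros n. apply Rle_trans with (1 * Rabs (conv a b n));
      [now apply Cmod_RtoC_mult_le, Cmod_pow_le_1|].
    rewrite Rmult_1_l. unfold conv.
    apply Rle_trans with (1 := Rsum_abs _ _).
    right. apply sum_eq. intros k _. apply Rabs_mult.
  - eexists. apply (is_series_mult_pos _ _ _ _ (Series_correct _ Sa) (Series_correct _ Sb));
      intros n; apply Rabs_pos.
Qed.

Lemma Cpseries_at_0 (a : nat -> R) : sqr_summable a -> Cpseries a (RtoC 0) = RtoC (a 0%nat).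
Proof.
  intros Ha. assert (H0 : Cmod (RtoC 0) <= 1) by (rewrite Cmod_0; lra).
  rewrite Cpseries_split by assumption. unfold Ctail.
  rewrite (Cseries_ext _ (fun n => RtoC 0 * (RtoC (a (S (S n))) * RtoC 0 ^ S (S n)))%C)
    by (intros n; rewrite Cpow_S; ring).
  rewrite Cseries_scal by now apply Ctail_summable. ring.
Qed.

(** The powers of z/2 in the two Bessel products are both (z/2)^(2 nu); against the
    prefactor z^(-2 nu) they leave 2^(-2 nu), and the Gamma factors leave nu + 1. *)
Lemma turanian_F (nu : R) (z : C) : 0 <= nu -> unit_disc z -> turanian nu z = F nu (z ^ 2).
Proof.
  intros Hnu Hz. unfold unit_disc in Hz. rewrite F_Cpseries. unfold turanian.
  destruct (Ceq_dec z (RtoC 0)) as [->|Hz0].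
  { replace (RtoC 0 ^ 2)%C with (RtoC 0) by (simpl; ring).
    rewrite Cpseries_at_0 by now apply signed_coef_sqr_summable.
    unfold signed_coef, coef. simpl. f_equal. field. }
  assert (H2 : RtoC 2 <> RtoC 0) by (intros H; apply RtoC_inj in H; lra).
  set (t := ((z / RtoC 2) ^ 2)%C).
  assert (Ht : Cmod t <= 1).
  { apply Cmod_pow_le_1. rewrite Cmod_div, Cmod_R, Rabs_pos_eq by (trivial; lra).
    apply Rle_div_l; lra. }
  pose proof (bessel_mid_sqr_summable nu Hnu) as Rm. pose proof (bessel_low_sqr_summable nu Hnu) as Rl.
  pose proof (bessel_high_sqr_summable nu Hnu) as Rh.
  rewrite (besselJ_Cpseries nu (rGamma (nu + 1)) (bessel_mid nu) z
    (fun n => besselJ_mid_coef nu n Hnu) Rm Ht).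
  rewrite (besselJ_Cpseries (nu - 1) (rGamma (nu + 1)) (bessel_low nu) z
    (fun n => besselJ_low_coef nu n Hnu) Rl Ht).
  rewrite (besselJ_Cpseries (nu + 1) (rGamma (nu + 1)) (bessel_high nu) z
    (fun n => besselJ_high_coef nu n Hnu) Rh Ht).
  fold t. set (y := (z / RtoC 2)%C) in *. set (G := rGamma (nu + 1)).
  assert (HG : 0 < G) by (apply rGamma_pos; lra).
  assert (HG2 : rGamma (nu + 2) = G / (nu + 1)).
  { unfold G. rewrite (rGamma_functional (nu + 1)) by lra.
    replace (nu + 1 + 1) with (nu + 2) by ring. field. lra. }
  assert (Hser : (RtoC (nu + 1) * (Cpseries (bessel_mid nu) t * Cpseries (bessel_mid nu) t
            - Cpseries (bessel_low nu) t * Cpseries (bessel_high nu) t))%C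
          = Cpseries (signed_coef nu) (z ^ 2)).
  { rewrite !Cpseries_mult by now apply sqr_summable_Csummable.
    rewrite (Cpseries_minus_scal _ _ (fun n => 4 ^ n * signed_coef nu n));
      [| now apply conv_Csummable | now apply conv_Csummable
       | intros n; now apply turanian_coefficient].
    rewrite Cpseries_scale_arg. f_equal. unfold t, y. simpl.
    replace (RtoC 4) with (RtoC 2 * RtoC 2)%C by (rewrite <- RtoC_mult; f_equal; ring).
    field. }
  assert (Hpow : (RtoC (Rpower 2 (2 * nu)) * Cpowr z (- (2 * nu)) * Cpowr y (2 * nu))%C
                 = RtoC 1).
  { unfold y. rewrite Cpowr_half by exact Hz0.
    transitivity (RtoC (Rpower 2 (2 * nu) * Rpower (1 / 2) (2 * nu))
      * (Cpowr z (- (2 * nu)) * Cpowr z (2 * nu)))%C; [rewrite RtoC_mult; ring|].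
    rewrite <- Cpowr_plus, Rpower_mult_distr by lra.
    replace (- (2 * nu) + 2 * nu) with 0 by ring. replace (2 * (1 / 2)) with 1 by field.
    rewrite Cpowr_0. unfold Rpower. rewrite ln_1, Rmult_0_r, exp_0. ring. }
  assert (Hmid : (Cpowr y nu * Cpowr y nu)%C = Cpowr y (2 * nu))
    by (rewrite <- Cpowr_plus; f_equal; ring).
  assert (Hside : (Cpowr y (nu - 1) * Cpowr y (nu + 1))%C = Cpowr y (2 * nu))
    by (rewrite <- Cpowr_plus; f_equal; ring).
  unfold Gamma. rewrite HG2. fold G.
  replace (Rpower 2 (2 * nu) * / G * / (G / (nu + 1)))
    with (Rpower 2 (2 * nu) * ((nu + 1) * / (G * G))) by (field; lra).
  rewrite <- Hser, !RtoC_mult.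
  set (A := Cpseries (bessel_mid nu) t). set (B := Cpseries (bessel_low nu) t).
  set (D := Cpseries (bessel_high nu) t).
  transitivity (RtoC (Rpower 2 (2 * nu)) * Cpowr z (- (2 * nu)) * RtoC (nu + 1)
     * (RtoC (/ (G * G)) * RtoC G * RtoC G)
     * ((Cpowr y nu * Cpowr y nu) * (A * A)
        - (Cpowr y (nu - 1) * Cpowr y (nu + 1)) * (B * D)))%C; [simpl; ring|].
  rewrite Hmid, Hside, <- !RtoC_mult.
  replace (/ (G * G) * G * G) with 1 by (field; lra).
  transitivity ((RtoC (Rpower 2 (2 * nu)) * Cpowr z (- (2 * nu)) * Cpowr y (2 * nu))
     * (RtoC (nu + 1) * (A * A - B * D)))%C; [ring|].
  rewrite Hpow. ring.
Qed.

(** * Subordination of the hypergeometric functions and images of Turanians *)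

(** The components of the root of x + i y are, up to sign, the square roots of
    (|w| + x)/2 and (|w| - x)/2. *)
Lemma Csqrt_exists (w : C) : exists z : C, (z ^ 2)%C = w.
Proof.
  pose proof (re_le_Cmod w) as Hre. apply Rabs_le_between in Hre.
  destruct w as [x y]. set (r := Cmod (x, y)) in *. simpl in Hre.
  set (a := sqrt ((r + x) / 2)). set (b := sqrt ((r - x) / 2)).
  assert (Ha : a * a = (r + x) / 2) by (apply sqrt_sqrt; lra).
  assert (Hb : b * b = (r - x) / 2) by (apply sqrt_sqrt; lra).
  assert (Hab : 2 * (a * b) = Rabs y).
  { unfold a, b. rewrite <- sqrt_mult_alt by lra.
    replace ((r + x) / 2 * ((r - x) / 2)) with (Rsqr (y / 2)).
    - rewrite sqrt_Rsqr_abs, Rabs_div, (Rabs_pos_eq 2) by lra. field.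
    - pose proof (Cmod_sqr (x, y)) as H. fold r in H. simpl in H. unfold Rsqr. lra. }
  unfold Rabs in Hab. destruct (Rcase_abs y) as [Hy|Hy].
  - exists (a, - b). simpl. unfold Cmult. simpl. f_equal; lra.
  - exists (a, b). simpl. unfold Cmult. simpl. f_equal; lra.
Qed.

Lemma unit_disc_sqr (z : C) : unit_disc (z ^ 2) <-> unit_disc z.
Proof.
  unfold unit_disc. rewrite Cmod_pow. pose proof (Cmod_ge_0 z). split; nra.
Qed.

Theorem theorem6 (p q : R) (hq : 0 <= q) (hpq : q < p) :
  subordinate (F p) (F q) /\
  (forall w : C,
    image (turanian p) unit_disc w -> image (turanian q) unit_disc w).
Proof.
  pose proof (subordinate_F p q hq hpq) as Hsub. split; [exact Hsub|].
  destruct Hsub as (_ & _ & omega & _ & Hdisc & _ & Hom).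
  intros w (z & Hz & Hw). rewrite turanian_F in Hw by (trivial; lra).
  pose proof (proj2 (unit_disc_sqr z) Hz) as Hz2.
  rewrite Hom in Hw by exact Hz2.
  destruct (Csqrt_exists (omega (z ^ 2)%C)) as [v Hv].
  pose proof (Hdisc _ Hz2) as Hd. rewrite <- Hv in Hd.
  apply (unit_disc_sqr v) in Hd.
  exists v. split; [exact Hd|]. rewrite turanian_F, Hv by trivial. exact Hw.
Qed.
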